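(* Let $f:\mathbb{R}^d\to\mathbb{R}\cup\{+\infty\}$ be a closed convex function such that $D:=\operatorname{int}\operatorname{dom} f\neq\emptyset$. Let $j\in\{1,\dots,d\}$ and let $A$ be a closed set in $\mathbb{R}^d$ containing $\operatorname{range}\nabla f$. Then $$\Sigma^j(\partial f)\cap D=\Sigma^j(\overline{\partial} f)\cap D=\Sigma^j_A(\partial f)\cap D,\qquad \Sigma^j(\overline{\partial} f)\subset\Sigma^j_A(\partial f).$$ If $y^j=z^j$ for all $y,z\in A$, then $\Sigma^j_A(\partial f)=\emptyset$. Otherwise, for every $n\ge 1$ there exist a compact set $C_n\subset A-A$ with $y^j>0$ for all $y\in C_n$, and a function $h_n\in\mathcal{H}^j_{\theta^j(C_n)}$, such that $$\Sigma^j_A(\partial f)\subset\bigcup_{n\ge1}\{x\in\mathbb{R}^d:\ h_n(x)=0\}.$$ Moreover, for any $\epsilon>0$, all the $C_n$ can be chosen so that $\operatorname{diam}\theta^j(C_n)<\epsilon$.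
   Context: Closed convex function: convex, lower semicontinuous, not identically $+\infty$; $\operatorname{dom} f=\{x: f(x)<\infty\}$. $A-A=\{a-b: a,b\in A\}$; $\operatorname{diam}E=\sup_{x,y\in E}|x-y|$ (Euclidean norm). Gradient and subdifferentials. $\operatorname{dom}\nabla f=\{x\in D: f\text{ is differentiable at }x\}$ and $\operatorname{range}\nabla f=\{\nabla f(x): x\in\operatorname{dom}\nabla f\}$. $\partial f(x)=\{y\in\mathbb{R}^d:\langle z,y\rangle\le f(x+z)-f(x)\ \forall z\in\mathbb{R}^d\}$ for $x\in\operatorname{dom}f$, and $\partial f(x)=\emptyset$ if $f(x)=+\infty$. The Clarke-type subdifferential is $$\overline{\partial} f(x)=\operatorname{cl}\operatorname{conv}\{\lim_n\nabla f(x_n):\ x_n\in\operatorname{dom}\nabla f,\ x_n\to x\},\quad x\in\operatorname{cl}D$$ (over all sequences for which the limit of gradients exists), and $\overline{\partial} f(x)=\emptyset$ for $x\notin\operatorname{cl}D$. Singular sets. For a set-valued map $\Psi$ from $\mathbb{R}^d$ to closed subsets of $\mathbb{R}^d$, with $\operatorname{dom}\Psi=\{x:\Psi(x)\ne\emptyset\}$, and a closed set $A\subset\mathbb{R}^d$, $$\Sigma^j_A(\Psi)=\{x\in\operatorname{dom}\Psi:\ \exists\, y_1,y_2\in\Psi(x)\cap A\text{ with }y_1^j\ne y_2^j\},\qquad \Sigma^j(\Psi)=\Sigma^j_{\mathbb{R}^d}(\Psi).$$ Function classes. $x^j$ is the $j$th coordinate of $x\in\mathbb{R}^d$ and $x^{-j}\in\mathbb{R}^{d-1}$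 is $x$ with its $j$th coordinate removed. For a compact set $C\subset\{x\in\mathbb{R}^d: x^j>0\}$, $\theta^j(C)=\{y/y^j: y\in C\}$, a compact set all of whose elements have $j$th coordinate $1$. For a compact set $C$ all of whose elements have $j$th coordinate equal to $1$, $\mathcal{H}^j_C$ is the family of functions $h$ on $\mathbb{R}^d$ of the form $$h(x)=x^j+g_1(x^{-j})-g_2(x^{-j}),$$ where $g_1,g_2:\mathbb{R}^{d-1}\to\mathbb{R}$ are convex, have linear growth ($|g_i(u)|\le K(1+|u|)$ for some constant $K>0$ and all $u$), and $\nabla h(x)\in C$ whenever both $g_1$ and $g_2$ are differentiable at $x^{-j}$. *)

(* Defs.v *)
From HB Require Import structures.
From mathcomp Require Import all_boot all_order all_algebra.
From mathcomp Require Import all_classical all_reals all_analysis.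

Set Implicit Arguments.
Unset Strict Implicit.
Unset Printing Implicit Defensive.

Import Order.TTheory GRing.Theory Num.Theory.
Import numFieldNormedType.Exports.

Local Open Scope classical_set_scope.
Local Open Scope ring_scope.

(* R^d is 'rV[R]_d.  The library norm `|x| on 'rV[R]_d is the sup norm: it gives
   the usual topology and notion of differentiability, but wherever a length
   matters the Euclidean norm [enorm] is used. *)

Section Euclidean.
Context {R : realType} {d : nat}.
Implicit Types (x y : 'rV[R]_d) (A E : set 'rV[R]_d).

Definition dot x y : R := \sum_i x 0 i * y 0 i.

Definition enorm x : R := Num.sqrt (dot x x).

Definition diam E : \bar R := ereal_sup [set (enorm (x - y))%:E | x in E & y in E].

Definition diff_set A : set 'rV[R]_d := [set a - b | a in A & b in A].

Definition grad (g : 'rV[R]_d -> R^o) x : 'rV[R]_d :=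
  \row_i 'D_(delta_mx 0 i) g x.

End Euclidean.

Section ConvexFunctions.
Context {R : realType} {d : nat}.
Implicit Types (f : 'rV[R]_d -> \bar R) (x y z : 'rV[R]_d).

Definition edom f : set 'rV[R]_d := [set x | (f x < +oo)%E].

(* For f with values in R \cup {+oo}.  In \bar R, 0 * +oo = 0, so the endpoints
   t = 0 and t = 1 impose nothing. *)
Definition econvex f : Prop :=
  forall x y (t : R), 0 <= t <= 1 ->
    (f (t *: x + (1 - t) *: y)%R <= t%:E * f x + (1 - t)%:E * f y)%E.

Definition closed_convex f : Prop :=
  [/\ econvex f, lower_semicontinuous f & edom f !=set0].

Definition int_dom f : set 'rV[R]_d := interior (edom f).

(* f is finite on the open set [int_dom f], so near such a point it coincides
   with the real-valued function [fine \o f]. *)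
Definition dom_grad f : set 'rV[R]_d :=
  [set x | int_dom f x /\ differentiable (fine \o f : 'rV[R]_d -> R^o) x].

Definition egrad f x : 'rV[R]_d := grad (fine \o f) x.

Definition range_grad f : set 'rV[R]_d := egrad f @` dom_grad f.

Definition subdiff f x : set 'rV[R]_d :=
  [set y | edom f x /\ forall z, ((dot z y)%:E <= f (x + z)%R - f x)%E].

Definition grad_limits f x : set 'rV[R]_d :=
  [set y | exists u : nat -> 'rV[R]_d,
    [/\ forall n, dom_grad f (u n),
        u n @[n --> \oo] --> x &
        egrad f (u n) @[n --> \oo] --> y]].

Definition conv_hull (E : set 'rV[R]_d) : set 'rV[R]_d :=
  smallest (@convex_set R 'rV[R]_d) E.

Definition clarke f x : set 'rV[R]_d :=
  [set y | closure (int_dom f) x /\ closure (conv_hull (grad_limits f x)) y].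

End ConvexFunctions.

Section SingularSets.
Context {R : realType} {d : nat}.
Implicit Types (j : 'I_d) (A C : set 'rV[R]_d) (Psi : 'rV[R]_d -> set 'rV[R]_d).

Definition Sigma_in j A Psi : set 'rV[R]_d :=
  [set x | Psi x !=set0 /\
    exists y1 y2, [/\ (Psi x `&` A) y1, (Psi x `&` A) y2 & y1 0 j <> y2 0 j]].

Definition Sigma j Psi : set 'rV[R]_d := Sigma_in j setT Psi.

Definition theta j C : set 'rV[R]_d := [set (y 0 j)^-1 *: y | y in C].

Definition linear_growth {m : nat} (g : 'rV[R]_m -> R) : Prop :=
  exists2 K : R, 0 < K & forall u, `|g u| <= K * (1 + enorm u).

(* x^{-j} is [col' j x].  The class is meant for compact C all of whose elements
   have j-th coordinate 1. *)
Definition Hclass j C : set ('rV[R]_d -> R) :=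
  [set h : 'rV[R]_d -> R | exists g1 g2 : 'rV[R]_d.-1 -> R^o,
    [/\ convex_function setT g1 /\ convex_function setT g2,
        linear_growth g1 /\ linear_growth g2,
        forall x : 'rV[R]_d, h x = x 0 j + g1 (col' j x) - g2 (col' j x) &
        forall x : 'rV[R]_d, differentiable g1 (col' j x) ->
          differentiable g2 (col' j x) -> C (grad h x)]].

(* The families are indexed by n = 0, 1, 2, ... *)
Definition zero_set_cover j A (S : set 'rV[R]_d)
    (C : nat -> set 'rV[R]_d) (h : nat -> 'rV[R]_d -> R) : Prop :=
  [/\ forall n, compact (C n) /\ C n `<=` diff_set A,
      forall n y, C n y -> 0 < y 0 j,
      forall n, Hclass j (theta j (C n)) (h n) &
      S `<=` \bigcup_n [set x | h n x = 0]].

End SingularSets.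

(* Main.v *)
(* Two convex functions which are suprema of affine functions over compact sets Q1 and
   Q2 of pairs (slope, constant), with j-th slopes at most c1 on Q1 and at least c2 > c1
   on Q2, agree at exactly one point t = T(u) of each line parallel to e_j, where they
   take a common value S(u). For c in [c1, c2], S(u) - c T(u) is the minimum over t of
   the larger of the two functions minus c t, hence convex in u, so that T is a
   difference of convex functions and the graph of T is the zero set of a function of
   the class H^j. Wherever the two convex functions are differentiable, the affine pieces
   attaining both suprema are tangent to S along the graph, so the normal to the graph is
   a normalised difference of a slope in Q2 and a slope in Q1.

   If y1, y2 in A are subgradients of f at x with y1^j < y2^j, take for Q1 and Q2 the
   affine minorants of f with slopes in A close to y1 and to y2: both suprema agree with
   f at x, so x lies on the graph. Rational centres make the family countable.

   In the interior of the domain, convexity and monotonicity of the subdifferential along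
   the rays x + t e_j and x - t e_j give limits of gradients whose j-th coordinates are at
   least, respectively at most, that of a given subgradient; conversely limits of
   gradients are subgradients in A. Density of the points of differentiability is obtained
   by touching f from above with a paraboloid. *)
Require Import Defs.
From HB Require Import structures.
From mathcomp Require Import all_boot all_order all_algebra.
From mathcomp Require Import all_classical all_reals all_analysis.
From mathcomp Require Import ring lra.
Import Order.TTheory GRing.Theory Num.Theory.
Import numFieldNormedType.Exports.
Local Open Scope classical_set_scope.
Local Open Scope ring_scope.

Set Implicit Arguments.
Unset Strict Implicit.

(** * Row vectors *)

Lemma cvg_of_harmonic_bound (R : realType) (V : normedModType R) (u : nat -> V) (l : V)
    (C : R) : (forall n, `|u n - l| <= C / n.+1%:R) -> u n @[n --> \oo] --> l.
Proof.
move=> uC; apply/cvgrPdist_le => e e0.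
(* [C] carries no sign, so [|C| + 1] replaces it as a positive constant to divide by. *)
have C0 : 0 < `|C| + 1 by rewrite ltr_wpDl.
near=> n; rewrite distrC (le_trans (uC n))//.
apply: (@le_trans _ _ ((`|C| + 1) * n.+1%:R^-1)).
  by rewrite ler_wpM2r// (le_trans (ler_norm _))// lerDl.
rewrite -ler_pdivlMl//.
have : `|0 - harmonic n| <= (`|C| + 1)^-1 * e :> R.
  near: n; apply: cvgr_dist_le; first exact: cvg_harmonic.
  by rewrite mulr_gt0// invr_gt0.
by rewrite sub0r normrN ger0_norm// /harmonic /= invr_ge0.
Unshelve. all: by end_near. Qed.

Section Dot.
Context {R : realType} {d : nat}.
Implicit Types x y z : 'rV[R]_d.

Lemma dotC x y : dot x y = dot y x.
Proof. by apply: eq_bigr => i _; rewrite mulrC. Qed.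

Lemma dotDr x y z : dot x (y + z) = dot x y + dot x z.
Proof. by rewrite -big_split; apply: eq_bigr => i _; rewrite mxE mulrDr. Qed.

Lemma dotZr x (a : R) y : dot x (a *: y) = a * dot x y.
Proof. by rewrite mulr_sumr; apply: eq_bigr => i _; rewrite mxE mulrCA. Qed.

Lemma dot0r x : dot x 0 = 0.
Proof. by rewrite /dot big1// => i _; rewrite mxE mulr0. Qed.

Lemma dotDl x y z : dot (x + y) z = dot x z + dot y z.
Proof. by rewrite dotC dotDr ![dot z _]dotC. Qed.

Lemma dotZl (a : R) x y : dot (a *: x) y = a * dot x y.
Proof. by rewrite dotC dotZr dotC. Qed.

Lemma dotNr x y : dot x (- y) = - dot x y.
Proof. by rewrite -scaleN1r dotZr mulN1r. Qed.

Lemma dotNl x y : dot (- x) y = - dot x y.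
Proof. by rewrite dotC dotNr dotC. Qed.

Lemma dotBl x y z : dot (x - y) z = dot x z - dot y z.
Proof. by rewrite dotDl dotNl. Qed.

Lemma dotBr x y z : dot x (y - z) = dot x y - dot x z.
Proof. by rewrite dotDr dotNr. Qed.

Lemma dot_deltal i y : dot (delta_mx 0 i) y = y 0 i.
Proof.
rewrite /dot (bigD1 i)//= mxE !eqxx mul1r big1 ?addr0// => k ki.
by rewrite mxE (negbTE ki) mul0r.
Qed.

Lemma dot_col' j x y : dot x y = x 0 j * y 0 j + dot (col' j x) (col' j y).
Proof.
by rewrite /dot (bigD1_ord j)//=; congr (_ + _); apply: eq_bigr => i _; rewrite !mxE.
Qed.

Lemma normr_coord x i : `|x 0 i| <= `|x|.
Proof.
rewrite [leRHS]/Num.norm /= mx_normrE.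
by apply: (@le_bigmax _ _ _ _ (fun ij => `|x ij.1 ij.2|) (0, i)).
Qed.

Lemma normr_rV_le x (a : R) : 0 <= a -> (forall i, `|x 0 i| <= a) -> `|x| <= a.
Proof.
move=> a0 xa; rewrite [leLHS]/Num.norm /= mx_normrE.
by apply/bigmax_leP; split=> // -[i k] _ /=; rewrite ord1.
Qed.

Lemma normr_dot x y : `|dot x y| <= d%:R * (`|x| * `|y|).
Proof.
apply: (le_trans (ler_norm_sum _ _ _)).
rewrite mulr_natl -[X in _ *+ X]card_ord -sumr_const.
by apply: ler_sum => i _; rewrite normrM ler_pM// normr_coord.
Qed.

Lemma dotxx_ge0 x : 0 <= dot x x.
Proof. by apply: sumr_ge0 => i _; rewrite -expr2 sqr_ge0. Qed.

Lemma normr_le_enorm x : `|x| <= enorm x.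
Proof.
apply: normr_rV_le => [|i]; first exact: sqrtr_ge0.
rewrite -sqrtr_sqr ler_sqrt ?dotxx_ge0// /dot (bigD1 i)//= -expr2 lerDl.
by apply: sumr_ge0 => k _; rewrite -expr2 sqr_ge0.
Qed.

Lemma normr2_le_dot x : `|x| ^+ 2 <= dot x x.
Proof.
rewrite -[leRHS]sqr_sqrtr ?dotxx_ge0// lerXn2r ?nnegrE ?sqrtr_ge0//.
exact: normr_le_enorm.
Qed.

Lemma enorm_le x : enorm x <= Num.sqrt d%:R * `|x|.
Proof.
rewrite -[X in _ * X]ger0_norm// -sqrtr_sqr -sqrtrM// ler_sqrt ?mulr_ge0 ?sqr_ge0//.
by rewrite (le_trans (ler_norm _))// (le_trans (normr_dot _ _))// expr2.
Qed.

Lemma cvg_coord (T : Type) (F : set_system T) (FF : Filter F) (f : T -> 'rV[R]_d) x i :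
  f t @[t --> F] --> x -> f t 0 i @[t --> F] --> x 0 i.
Proof.
move=> fx; apply: (@continuous_cvg _ _ _ _ _ f (fun y : 'rV[R]_d => y 0 i)) => //.
exact: coord_continuous.
Qed.

Lemma cvg_dot (T : Type) (F : set_system T) (FF : Filter F) (f g : T -> 'rV[R]_d) x y :
  f t @[t --> F] --> x -> g t @[t --> F] --> y ->
  dot (f t) (g t) @[t --> F] --> dot x y.
Proof.
move=> fx gy; rewrite /dot; apply: cvg_big => [|i _]; first exact: add_continuous.
by apply: cvgM; exact: cvg_coord.
Qed.

Lemma compact_norm_le x (r : R) : compact [set z : 'rV[R]_d | `|z - x| <= r].
Proof.
apply: bounded_closed_compact.
  exists (`|x| + r); split; first exact: num_real.
  move=> M Mr z /= zx; rewrite -(subrK x z) (le_trans (ler_normD _ _))//.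
  by rewrite addrC; apply: le_trans (ltW Mr); rewrite lerD2l.
apply: (@preimage_closed _ _ (fun z : 'rV[R]_d => `|z - x|) [set t | t <= r]).
  move=> z _; apply: (@cvg_norm _ _ _ (nbhs z) _ (fun z => z - x)).
  by apply: (@cvgB _ _ _ (nbhs z) _ id (cst x)); [exact: cvg_id|exact: cvg_cst].
exact: closed_le.
Qed.

(** The pairing with a fixed [y], with codomain [R^o] so that linearity and [is_derive] instances
    can be attached to it. *)
Definition dotr y x : R^o := dot x y.

Lemma dotr_is_linear y : linear (dotr y).
Proof. by move=> a x z; rewrite /dotr dotDl dotZl. Qed.

HB.instance Definition _ y :=
  GRing.isLinear.Build R 'rV[R]_d R^o *:%R (dotr y) (dotr_is_linear y).

Lemma dotr_continuous y : continuous (dotr y).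
Proof.
by move=> x; apply: (@cvg_dot _ (nbhs x) _ id (fun=> y)); [exact: cvg_id|exact: cvg_cst].
Qed.

Lemma differentiable_dotr x y : differentiable (dotr y) x.
Proof. by apply: linear_differentiable; exact: dotr_continuous. Qed.

Global Instance is_derive_dotr x y z : is_derive x z (dotr y) (dot z y).
Proof.
apply: DeriveDef; first by apply: diff_derivable; exact: differentiable_dotr.
rewrite deriveE; last exact: differentiable_dotr.
by rewrite diff_lin//; exact: dotr_continuous.
Qed.

(** Bolzano-Weierstrass, from a cluster point in a compact ball. The extraction [k] is not made
    monotone; [n <= k n] suffices to preserve limits. *)
Lemma bounded_seq_cvg (u : nat -> 'rV[R]_d) (M : R) : (forall n, `|u n| <= M) ->
  exists (k : nat -> nat) (l : 'rV[R]_d), (forall n, (n <= k n)%N) /\ u (k n) @[n --> \oo] --> l.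
Proof.
move=> uM; have [|l [_ lu]] := @compact_norm_le 0 M (u n @[n --> \oo]) _.
  by exists 0 => // n _ /=; rewrite subr0.
have /choice[k kP] : forall n, exists m, (n <= m)%N /\ `|u m - l| <= 1 / n.+1%:R.
  move=> n; have [||_ [[m nm <-] lm]] := lu [set u m | m in [set m | (n <= m)%N]]
    [set z | `|l - z| < n.+1%:R^-1].
  - by exists n => // m nm; exists m.
  - apply: (@cvgr_dist_lt _ _ _ (nbhs l) _ id l); first exact: cvg_id.
    by rewrite invr_gt0.
  - by exists m; split => //; rewrite mul1r distrC ltW.
exists k, l; split=> [n|]; first by have [] := kP n.
by apply: (@cvg_of_harmonic_bound _ _ _ _ 1) => n; have [] := kP n.
Qed.

End Dot.

(** * Upper envelopes of affine functions *)

Section Crossing.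
Context {R : realType} {d : nat} (j : 'I_d).
Implicit Types (q : 'rV[R]_d * R) (Q : set ('rV[R]_d * R)) (u : 'rV[R]_d.-1) (s t : R).

(** A pair [q] stands for the affine function with slope [q.1] and constant term [- q.2]. The [j]-th
    coordinate [t] is kept apart from the others, [u], because envelopes are compared along lines
    parallel to e_j. *)
Definition affine_at q t u : R := t * q.1 0 j + dot u (col' j q.1) - q.2.

Lemma affine_at_dot q (x : 'rV[R]_d) : affine_at q (x 0 j) (col' j x) = dot x q.1 - q.2.
Proof. by rewrite (dot_col' j). Qed.

Lemma affine_atB q t t' u :
  affine_at q t u - affine_at q t' u = (t - t') * q.1 0 j.
Proof. by rewrite /affine_at; ring. Qed.

Lemma affine_at_continuous t u : continuous (fun q => affine_at q t u).
Proof.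
(* [e] is the point with [j]-th coordinate [t] and remaining coordinates [u]; continuity then
   follows from that of [dot]. *)
pose e : 'rV[R]_d := t *: delta_mx 0 j + \row_k (if unlift j k is Some i then u 0 i else 0).
have e0 : e 0 j = t by rewrite !mxE !eqxx unlift_none mulr1 addr0.
have eu : col' j e = u.
  apply/rowP => i; rewrite !mxE liftK eqxx eq_sym (negbTE (neq_lift _ _)).
  by rewrite mulr0 add0r.
rewrite -e0 -eu (_ : (fun q => _) = (fun q => dot e q.1 - q.2)); last first.
  by apply/funext => q; rewrite affine_at_dot.
move=> q; apply: cvgB; last exact: cvg_snd.
by apply: cvg_dot; [exact: cvg_cst|exact: cvg_fst].
Qed.

(** The supremum as an attained maximum: the first half supplies a piece through the value, the
    second the upper bound. *)
Definition envelope_at Q t u s :=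
  (exists2 q, Q q & affine_at q t u = s) /\ (forall q, Q q -> affine_at q t u <= s).

Lemma envelope_ex Q t u : compact Q -> Q !=set0 -> exists s, envelope_at Q t u s.
Proof.
move=> cQ Q0; have [|q Qq qmax] := @compact_EVT_max _ R (fun q => affine_at q t u) Q Q0 cQ.
  by apply: continuous_subspaceT; exact: affine_at_continuous.
exists (affine_at q t u); split; first by exists q => //; rewrite -inE.
by move=> q' Qq'; apply: qmax; rewrite inE.
Qed.

Lemma compact_slope_bounded Q : compact Q ->
  exists2 M : R, 0 < M & forall q, Q q -> `|q.1| <= M /\ `|q.2| <= M.
Proof.
move=> /compact_bounded/ex_strict_bound_gt0[M M0 QM]; exists M => // q /QM/ltW.
by rewrite prod_normE ge_max => /andP[].
Qed.

(** The piece attaining the maximum at [t] bounds the envelope at [t'] from below. *)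
Lemma envelope_lipschitz Q M t t' u s s' :
  (forall q, Q q -> `|q.1| <= M) -> envelope_at Q t u s -> envelope_at Q t' u s' ->
  s - s' <= M * `|t - t'|.
Proof.
move=> QM [[q Qq <-] _] [_ Qs'].
apply: (@le_trans _ _ (affine_at q t u - affine_at q t' u)).
  by rewrite lerD2l lerN2 Qs'.
rewrite affine_atB (le_trans (ler_norm _))// normrM mulrC ler_wpM2r//.
exact: le_trans (normr_coord _ _) (QM _ Qq).
Qed.

(** The piece attaining the maximum at the left end [t'] bounds the increment from below; for the
    upper bound in [envelope_slope_le] it is the piece attaining it at [t]. *)
Lemma envelope_slope_ge Q (c : R) t t' u s s' : (forall q, Q q -> c <= q.1 0 j) ->
  t' <= t -> envelope_at Q t u s -> envelope_at Q t' u s' -> c * (t - t') <= s - s'.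
Proof.
move=> Qc tt' [_ Qs] [[q Qq <-] _]; have := Qs _ Qq; have := affine_atB q t t' u.
have : c * (t - t') <= q.1 0 j * (t - t') by rewrite ler_wpM2r ?subr_ge0// Qc.
rewrite [_ * q.1 0 j]mulrC; lra.
Qed.

Lemma envelope_slope_le Q (c : R) t t' u s s' : (forall q, Q q -> q.1 0 j <= c) ->
  t' <= t -> envelope_at Q t u s -> envelope_at Q t' u s' -> s - s' <= c * (t - t').
Proof.
move=> Qc tt' [[q Qq <-] _] [_ Qs]; have := Qs _ Qq; have := affine_atB q t t' u.
have : q.1 0 j * (t - t') <= c * (t - t') by rewrite ler_wpM2r ?subr_ge0// Qc.
rewrite [_ * q.1 0 j]mulrC; lra.
Qed.

Lemma lipschitz_continuous (g : R -> R) (M : R) : 0 < M ->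
  (forall t t', `|g t - g t'| <= M * `|t - t'|) -> continuous g.
Proof.
move=> M0 gM t; apply/cvgrPdist_lt => e e0; near=> t'.
apply: le_lt_trans (gM _ _) _; rewrite -ltr_pdivlMl//.
near: t'; apply: cvgr_dist_lt; first by [].
by rewrite mulr_gt0// invr_gt0.
Unshelve. all: by end_near. Qed.

(** The difference of the two envelopes is continuous in [t] and increases at rate at least
    [c2 - c1 > 0], so the intermediate value theorem gives a zero. *)
Lemma envelopes_cross Q1 Q2 (c1 c2 : R) u :
  compact Q1 -> compact Q2 -> Q1 !=set0 -> Q2 !=set0 -> c1 < c2 ->
  (forall q, Q1 q -> q.1 0 j <= c1) -> (forall q, Q2 q -> c2 <= q.1 0 j) ->
  exists t s, envelope_at Q1 t u s /\ envelope_at Q2 t u s.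
Proof.
move=> cQ1 cQ2 Q10 Q20 c12 Q1c Q2c.
have /choice[F1 F1E] : forall t, exists s, envelope_at Q1 t u s.
  by move=> t; exact: envelope_ex.
have /choice[F2 F2E] : forall t, exists s, envelope_at Q2 t u s.
  by move=> t; exact: envelope_ex.
have [M1 M10 Q1M] := compact_slope_bounded cQ1.
have [M2 M20 Q2M] := compact_slope_bounded cQ2.
pose D t := F2 t - F1 t.
have Dcont : continuous D.
  apply: (@lipschitz_continuous _ (M1 + M2)); first exact: addr_gt0.
  move=> t t'; rewrite /D mulrDl.
  have h1 := envelope_lipschitz (fun q Qq => (Q1M q Qq).1) (F1E t) (F1E t').
  have h2 := envelope_lipschitz (fun q Qq => (Q1M q Qq).1) (F1E t') (F1E t).
  have h3 := envelope_lipschitz (fun q Qq => (Q2M q Qq).1) (F2E t) (F2E t').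
  have h4 := envelope_lipschitz (fun q Qq => (Q2M q Qq).1) (F2E t') (F2E t).
  rewrite distrC in h2; rewrite distrC in h4.
  by rewrite ler_norml; apply/andP; split; lra.
have Dslope t t' : t' <= t -> (c2 - c1) * (t - t') <= D t - D t'.
  move=> tt'; have := envelope_slope_ge Q2c tt' (F2E t) (F2E t').
  by have := envelope_slope_le Q1c tt' (F1E t) (F1E t'); rewrite /D; lra.
(* Over a length [T] the difference [D] gains at least [|D 0|], which forces a sign change on
   [[-T, T]]. *)
pose T := `|D 0| / (c2 - c1).
have T0 : 0 <= T by rewrite divr_ge0// subr_ge0 ltW.
have TE : (c2 - c1) * T = `|D 0| by rewrite mulrC divfK// subr_eq0 gt_eqF.
have DT : 0 <= D T.
  by have := Dslope _ _ T0; rewrite subr0 TE; have := ler_norm (- D 0); rewrite normrN; lra.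
have DNT : D (- T) <= 0.
  have := @Dslope 0 (- T); rewrite oppr_le0 sub0r opprK TE => /(_ T0).
  by have := ler_norm (D 0); lra.
have [|||t _ Dt] := @IVT R D (- T) T 0; first by lra.
- exact: continuous_subspaceT.
- by rewrite ge_min DNT le_max DT orbT.
exists t, (F1 t); split; first exact: F1E.
by rewrite (_ : F1 t = F2 t); [exact: F2E|move: Dt; rewrite /D; lra].
Qed.

End Crossing.

(** * The crossing graph of two envelopes *)

Section DirectionalDerivative.
Context {R : realType} {V : normedModType R}.

Lemma derive_le_right (f : V -> R^o) (x v : V) (a : R) : derivable f x v ->
  (\forall h \near (0 : R)^'+, h^-1 * (f (h *: v + x) - f x) <= a) -> 'D_v f x <= a.
Proof.
move=> fxv fa; rewrite /derive cvg_at_rightE; last exact: fxv.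
apply: limr_le => //.
apply: cvgP; apply: cvg_trans fxv; apply: cvg_app.
by move=> A [e e0 eA]; exists e => // h he h0; apply: eA => //; exact: lt0r_neq0.
Qed.

(** At a minimum every directional derivative is nonnegative; linearity in the direction, applied to
    [v] and [- v], gives zero. *)
Lemma derive_at_min (f : V -> R^o) (x v : V) : differentiable f x ->
  (forall y, f x <= f y) -> 'D_v f x = 0.
Proof.
move=> dfx fmin; have D_ge0 w : 0 <= 'D_w f x.
  rewrite -oppr_le0 -deriveN; last exact: diff_derivable.
  apply: derive_le_right; first by apply: derivableN; exact: diff_derivable.
  near=> h; rewrite mulr_ge0_le0// ?invr_ge0//.
  by rewrite !fctE opprK addrC subr_le0.
apply/eqP; rewrite eq_le D_ge0 andbT -oppr_ge0.
by have := D_ge0 (- v); rewrite !deriveE// linearN.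
Unshelve. all: by end_near. Qed.

End DirectionalDerivative.

Section CrossingGraph.
Context {R : realType} {d : nat} (j : 'I_d).
Implicit Types (q : 'rV[R]_d * R) (Q : set ('rV[R]_d * R)) (u : 'rV[R]_d.-1).
Implicit Types (x : 'rV[R]_d) (c s t : R).

Lemma affine_at_conv q t t' u u' (a : R) :
  affine_at j q (a * t + (1 - a) * t') (a *: u + (1 - a) *: u') =
  a * affine_at j q t u + (1 - a) * affine_at j q t' u'.
Proof. by rewrite /affine_at dotDl !dotZl; ring. Qed.

Lemma normr_affine_at q t u (M : R) : `|q.1| <= M -> `|q.2| <= M ->
  `|affine_at j q t u| <= `|t| * M + d%:R * (enorm u * M) + M.
Proof.
move=> q1 q2; rewrite /affine_at (le_trans (ler_normB _ _))// lerD//.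
rewrite (le_trans (ler_normD _ _))// lerD//.
  by rewrite normrM ler_wpM2l// (le_trans (normr_coord _ _)).
rewrite (le_trans (normr_dot _ _))// ler_pM ?mulr_ge0//.
  by rewrite ler_nat leq_pred.
rewrite ler_pM// ?normr_le_enorm//; apply: normr_rV_le => [|i].
  exact: le_trans q1.
by rewrite mxE (le_trans (normr_coord _ _)).
Qed.

(* [s - c * t] is the minimum over [t'] of the larger envelope minus [c * t'], since
   after subtracting [c * t'] the first envelope decreases and the second increases. *)
Lemma crossing_min Q1 Q2 c1 c2 c t t' u s (z : R) :
  (forall q, Q1 q -> q.1 0 j <= c1) -> (forall q, Q2 q -> c2 <= q.1 0 j) ->
  c1 <= c <= c2 -> envelope_at j Q1 t u s -> envelope_at j Q2 t u s ->
  (forall q, Q1 q -> affine_at j q t' u <= z) ->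
  (forall q, Q2 q -> affine_at j q t' u <= z) ->
  s - c * t <= z - c * t'.
Proof.
move=> Q1c Q2c /andP[c1c cc2] [[q1 Qq1 s1] _] [[q2 Qq2 s2] _] Q1z Q2z.
have := affine_atB j q1 t' t u; have := affine_atB j q2 t' t u; rewrite s1 s2.
have [tt'|/ltW t't] := leP t t'.
- have : c * (t' - t) <= q2.1 0 j * (t' - t).
    by rewrite ler_wpM2r ?subr_ge0// (le_trans cc2) ?Q2c.
  by rewrite [_ * q2.1 0 j]mulrC; have := Q2z _ Qq2; lra.
- have : q1.1 0 j * (t - t') <= c * (t - t').
    by rewrite ler_wpM2r ?subr_ge0// (le_trans _ c1c) ?Q1c.
  by rewrite [_ * q1.1 0 j]mulrC; have := Q1z _ Qq1; lra.
Qed.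

(** Two crossings are competitors in each other's minimum, so [s - c * t] agrees for [c = c1] and
    for [c = c2]; subtracting leaves [(c2 - c1) * (t - t') = 0]. *)
Lemma crossing_uniq Q1 Q2 c1 c2 t t' u s s' :
  c1 < c2 ->
  (forall q, Q1 q -> q.1 0 j <= c1) -> (forall q, Q2 q -> c2 <= q.1 0 j) ->
  envelope_at j Q1 t u s -> envelope_at j Q2 t u s ->
  envelope_at j Q1 t' u s' -> envelope_at j Q2 t' u s' -> t = t'.
Proof.
move=> c12 Q1c Q2c e1 e2 e1' e2'.
have le1 : c1 <= c1 <= c2 by rewrite lexx ltW.
have le2 : c1 <= c2 <= c2 by rewrite lexx ltW.
have h1 := crossing_min Q1c Q2c le1 e1 e2 e1'.2 e2'.2.
have h2 := crossing_min Q1c Q2c le1 e1' e2' e1.2 e2.2.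
have h3 := crossing_min Q1c Q2c le2 e1 e2 e1'.2 e2'.2.
have h4 := crossing_min Q1c Q2c le2 e1' e2' e1.2 e2.2.
have : (c2 - c1) * (t - t') = 0 by lra.
by move/eqP; rewrite mulf_eq0 !subr_eq0 (gt_eqF c12) => /eqP.
Qed.

(** Each affine piece at a convex combination of two points of the graph stays below the combined
    value, so this combination is a competitor in [crossing_min]. *)
Lemma crossing_convex Q1 Q2 c1 c2 c (T S : 'rV[R]_d.-1 -> R) (a : R) :
  (forall q, Q1 q -> q.1 0 j <= c1) -> (forall q, Q2 q -> c2 <= q.1 0 j) ->
  (forall u, envelope_at j Q1 (T u) u (S u)) ->
  (forall u, envelope_at j Q2 (T u) u (S u)) ->
  c1 <= c <= c2 -> 0 <= a ->
  convex_function setT (fun u => a * (S u - c * T u) : R^o).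
Proof.
move=> Q1c Q2c TS1 TS2 cc a0 p u u' _ _.
pose b : R := p%:num.
(* Unfolds the library's abstract convex combinations into explicit sums. *)
change (a * (S (b *: u + (1 - b) *: u') - c * T (b *: u + (1 - b) *: u')) <=
  b * (a * (S u - c * T u)) + (1 - b) * (a * (S u' - c * T u'))).
have b0 : 0 <= b by rewrite /b ge0.
have b1 : 0 <= 1 - b by rewrite subr_ge0 /b le1.
have aff q : affine_at j q (T u) u <= S u -> affine_at j q (T u') u' <= S u' ->
    affine_at j q (b * T u + (1 - b) * T u') (b *: u + (1 - b) *: u') <=
    b * S u + (1 - b) * S u'.
  by move=> h h'; rewrite affine_at_conv lerD// ler_wpM2l.
have := crossing_min Q1c Q2c cc (TS1 (b *: u + (1 - b) *: u')) (TS2 _)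
  (fun q Qq => aff q ((TS1 _).2 _ Qq) ((TS1 _).2 _ Qq))
  (fun q Qq => aff q ((TS2 _).2 _ Qq) ((TS2 _).2 _ Qq)).
move=> /(ler_wpM2l a0)/le_trans; apply; rewrite le_eqVlt; apply/orP; left; apply/eqP; ring.
Qed.

(** At [t = 0] all pieces are bounded by some [B] of linear growth in [u]. Pieces from [Q1] and [Q2]
    meeting at height [T u] have slopes at least [c2 - c1] apart, which bounds [T] by a multiple of
    [B], and then [S]. *)
Lemma crossing_growth Q1 Q2 c1 c2 c (T S : 'rV[R]_d.-1 -> R) (a : R) :
  compact Q1 -> compact Q2 -> c1 < c2 ->
  (forall q, Q1 q -> q.1 0 j <= c1) -> (forall q, Q2 q -> c2 <= q.1 0 j) ->
  (forall u, envelope_at j Q1 (T u) u (S u)) ->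
  (forall u, envelope_at j Q2 (T u) u (S u)) ->
  linear_growth (fun u => a * (S u - c * T u)).
Proof.
move=> cQ1 cQ2 c12 Q1c Q2c TS1 TS2.
have [M1 M10 Q1M] := compact_slope_bounded cQ1.
have [M2 M20 Q2M] := compact_slope_bounded cQ2.
pose M := M1 + M2; have M0 : 0 < M by exact: addr_gt0.
pose k := c2 - c1; have k0 : 0 < k by rewrite subr_gt0.
pose L := `|a| * ((M + `|c|) * (2 / k) + 1).
have L0 : 0 <= L by rewrite mulr_ge0// addr_ge0// mulr_ge0 ?addr_ge0 ?divr_ge0// ltW.
have M_ge0 := ltW M0.
(* The added 1 makes the constant strictly positive even when [L = 0]. *)
exists (L * (M * d.+1%:R) + 1); first by rewrite ltr_wpDl// mulr_ge0// mulr_ge0.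
move=> u; pose B := d%:R * (enorm u * M) + M.
have eu0 : 0 <= enorm u by exact: sqrtr_ge0.
have B0 : 0 <= B by rewrite addr_ge0// !mulr_ge0.
have BM : B <= M * d.+1%:R * (1 + enorm u).
  rewrite /B -natr1; have : 0 <= M * enorm u by rewrite mulr_ge0.
  have : 0 <= (d%:R : R) * M by rewrite mulr_ge0.
  lra.
have [[q1 Qq1 s1] _] := TS1 u; have [[q2 Qq2 s2] _] := TS2 u.
have [q1M1 q1M2] : `|q1.1| <= M /\ `|q1.2| <= M.
  by have [] := Q1M _ Qq1; rewrite /M; lra.
have [q2M1 q2M2] : `|q2.1| <= M /\ `|q2.2| <= M.
  by have [] := Q2M _ Qq2; rewrite /M; lra.
have aB1 := normr_affine_at 0 u q1M1 q1M2; have aB2 := normr_affine_at 0 u q2M1 q2M2.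
rewrite normr0 mul0r add0r -/B in aB1; rewrite normr0 mul0r add0r -/B in aB2.
have TB : `|T u| <= 2 / k * B.
  rewrite mulrAC ler_pdivlMr// -[k]gtr0_norm// -normrM.
  have TE : T u * (q2.1 0 j - q1.1 0 j) = affine_at j q1 0 u - affine_at j q2 0 u.
    have := affine_atB j q1 (T u) 0 u; have := affine_atB j q2 (T u) 0 u.
    by rewrite s1 s2; lra.
  apply: (@le_trans _ _ `|T u * (q2.1 0 j - q1.1 0 j)|).
    rewrite !normrM ler_wpM2l// gtr0_norm//.
    by apply: le_trans (ler_norm _); rewrite lerB// ?Q1c ?Q2c.
  by rewrite TE (le_trans (ler_normB _ _))//; lra.
have SB : `|S u| <= `|T u| * M + B.
  by have := normr_affine_at (T u) u q1M1 q1M2; rewrite s1 -addrA.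
have LB : `|a * (S u - c * T u)| <= L * B.
  rewrite normrM -mulrA ler_wpM2l// (le_trans (ler_normB _ _))// normrM.
  apply: (@le_trans _ _ ((M + `|c|) * `|T u| + B)); first lra.
  by rewrite [leRHS]mulrDl mul1r lerD2r -mulrA ler_wpM2l// addr_ge0.
apply: (le_trans LB); rewrite mulrDl mul1r.
apply: (@le_trans _ _ (L * (M * d.+1%:R * (1 + enorm u)))); first by rewrite ler_wpM2l.
by rewrite mulrA lerDl addr_ge0.
Qed.

Definition slope_diff Q1 Q2 : set 'rV[R]_d :=
  [set q2.1 - q1.1 | q1 in Q1 & q2 in Q2].

Lemma col'D x y : col' j (x + y) = col' j x + col' j y.
Proof. by apply/rowP => i; rewrite !mxE. Qed.

Lemma col'_delta : col' j (delta_mx 0 j : 'rV[R]_d) = 0.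
Proof. by apply/rowP => i; rewrite !mxE eqxx eq_sym (negbTE (neq_lift _ _)). Qed.

Lemma col'_delta_lift (l : 'I_d.-1) :
  col' j (delta_mx 0 (lift j l) : 'rV[R]_d) = delta_mx 0 l.
Proof. by apply/rowP => i; rewrite !mxE (inj_eq lift_inj). Qed.

(** The difference quotient of [h] along e_j is constantly 1; along another coordinate it is the
    quotient of [g]. *)
Lemma grad_graph (g : 'rV[R]_d.-1 -> R^o) (h : 'rV[R]_d -> R) x :
  (forall x, h x = x 0 j + g (col' j x)) -> (grad h x) 0 j = 1 /\
  (forall l, (grad h x) 0 (lift j l) = 'D_(delta_mx 0 l) g (col' j x)).
Proof.
move=> hE; have colE (t : R) (i : 'I_d) :
    col' j (t *: delta_mx 0 i + x) = t *: col' j (delta_mx 0 i) + col' j x.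
  by rewrite col'D; congr (_ + _); apply/rowP => l; rewrite !mxE.
split=> [|l]; rewrite mxE /derive.
- apply: (@lim_near_cst R) => //.
  near=> t.
  rewrite /= !hE colE col'_delta scaler0 add0r !mxE !eqxx mulr1.
  rewrite (_ : _ - _ = t); last by ring.
  by rewrite /GRing.scale /= mulVf//; near: t; exact: nbhs_dnbhs_neq.
- rewrite (_ : (fun t => _) = fun t : R => t^-1 *:
    ((g \o shift (col' j x)) (t *: delta_mx 0 l) - g (col' j x)))//.
  apply/funext => t; congr (_ *: _).
  rewrite /= !hE colE col'_delta_lift !mxE eqxx (negbTE (neq_lift _ _)) mulr0 add0r.
  by ring.
Unshelve. all: by end_near. Qed.

(** The function is [h x = x 0 j - T (col' j x)], whose zero set is the crossing graph; both [T] and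
    [S] are combinations of two convex functions. *)
Lemma Hclass_crossing Q1 Q2 c1 c2 :
  compact Q1 -> compact Q2 -> Q1 !=set0 -> Q2 !=set0 -> c1 < c2 ->
  (forall q, Q1 q -> q.1 0 j <= c1) -> (forall q, Q2 q -> c2 <= q.1 0 j) ->
  exists2 h, Hclass j (theta j (slope_diff Q1 Q2)) h &
    forall x s, envelope_at j Q1 (x 0 j) (col' j x) s ->
      envelope_at j Q2 (x 0 j) (col' j x) s -> h x = 0.
Proof.
move=> cQ1 cQ2 Q10 Q20 c12 Q1c Q2c.
have /choice[T /choice[S TS]] : forall u, exists t s,
    envelope_at j Q1 t u s /\ envelope_at j Q2 t u s.
  by move=> u; exact: envelopes_cross c12 Q1c Q2c.
have TS1 u := (TS u).1; have TS2 u := (TS u).2.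
have k0 : c2 - c1 != 0 by rewrite subr_eq0 gt_eqF.
pose a := (c2 - c1)^-1; have a0 : 0 <= a by rewrite invr_ge0 subr_ge0 ltW.
(* The extreme choices [c2] and [c1] of [c], scaled so that [T = g2 - g1]. *)
pose g1 : 'rV[R]_d.-1 -> R^o := fun u => a * (S u - c2 * T u).
pose g2 : 'rV[R]_d.-1 -> R^o := fun u => a * (S u - c1 * T u).
have TE u : T u = g2 u - g1 u by rewrite /g1 /g2 /a; field.
have SE u : S u = c2 * g2 u - c1 * g1 u by rewrite /g1 /g2 /a; field.
exists (fun x => x 0 j + g1 (col' j x) - g2 (col' j x)); last first.
  move=> x s e1 e2; rewrite (crossing_uniq c12 Q1c Q2c e1 e2 (TS1 _) (TS2 _)) TE.
  by ring.
exists g1, g2; split => //.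
- by split; apply: (crossing_convex Q1c Q2c TS1 TS2) => //; rewrite ?lexx ltW.
- by split; apply: (crossing_growth _ _ cQ1 cQ2 c12 Q1c Q2c TS1 TS2).
move=> x dg1 dg2; set u0 := col' j x.
(* The gap between [S] and a piece evaluated along the graph is nonnegative and vanishes at [u0], so
   its derivatives there are zero: D S = q^j D T + q^l in direction [l]. *)
have tangent q : (forall u, affine_at j q (T u) u <= S u) ->
    affine_at j q (T u0) u0 = S u0 -> forall l,
    let D1 := 'D_(delta_mx 0 l) g1 u0 in let D2 := 'D_(delta_mx 0 l) g2 u0 in
    c2 * D2 - c1 * D1 - q.1 0 j * (D2 - D1) - q.1 0 (lift j l) = 0.
  move=> qS qu0 l D1 D2; pose v : 'rV[R]_d.-1 := delta_mx 0 l.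
  pose phi : 'rV[R]_d.-1 -> R^o := c2 *: g2 - c1 *: g1 - q.1 0 j *: (g2 - g1)
    - dotr (col' j q.1) + cst q.2.
  have phiE u : phi u = S u - affine_at j q (T u) u.
    by rewrite /phi !fctE /dotr /affine_at SE TE /GRing.scale /=; ring.
  have dphi : differentiable phi u0.
    apply: differentiableD; last exact: differentiable_cst.
    apply: differentiableB; last exact: differentiable_dotr.
    apply: differentiableB; last by apply/differentiableZ/differentiableB.
    by apply: differentiableB; exact: differentiableZ.
  have := derive_at_min (x := u0) v dphi; rewrite !phiE qu0 subrr.
  have Dg1 : is_derive u0 v g1 D1 by apply: derivableP; exact: diff_derivable.
  have Dg2 : is_derive u0 v g2 D2 by apply: derivableP; exact: diff_derivable.
  rewrite derive_val /GRing.scale /= dot_deltal !mxE addr0; apply.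
  by move=> u; rewrite phiE subr_ge0.
have [[q1 Qq1 s1] _] := TS1 u0; have [[q2 Qq2 s2] _] := TS2 u0.
have t1 := tangent _ (fun u => (TS1 u).2 _ Qq1) s1.
have t2 := tangent _ (fun u => (TS2 u).2 _ Qq2) s2.
have b0 : q2.1 0 j - q1.1 0 j != 0.
  by rewrite gt_eqF// subr_gt0 (le_lt_trans (Q1c _ Qq1))// (lt_le_trans c12)// Q2c.
exists (q2.1 - q1.1); first by exists q1 => //; exists q2.
have [gj gl] := @grad_graph (g1 - g2) (fun x => x 0 j + g1 (col' j x) - g2 (col' j x)) x
  (fun x => esym (addrA _ _ _)).
apply/rowP => i; case: (unliftP j i) => [l|] ->; last first.
  by rewrite gj !mxE mulVf.
rewrite gl deriveB; [|exact: diff_derivable|exact: diff_derivable].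
rewrite !mxE; have := t1 l; have := t2 l; rewrite /=.
set D1 := 'D_ _ g1 u0; set D2 := 'D_ _ g2 u0 => e2 e1.
(* Subtracting the tangency relations of [q1] and [q2] gives (q2 - q1)^j D T = - (q2 - q1)^l, while
   the gradient of [h] has [l]-th entry - D T. *)
apply: (mulfI b0); rewrite mulrA mulfV// mul1r; lra.
Qed.

End CrossingGraph.

(** * Differentiability of convex functions *)

Lemma differentiable_of_quadratic (R : realType) (V : normedModType R) (f : V -> R^o)
    (L : {linear V -> R^o}) (x : V) (C : R) : continuous L ->
  (\forall y \near x, `|f y - f x - L (y - x)| <= C * `|y - x| ^+ 2) ->
  differentiable f x.
Proof.
move=> Lc fL; apply/diffP => /=.
(* The differential is a chosen witness, so exhibiting one continuous linear map with little-o
   remainder is enough; the base point appears as [lim (nbhs x)]. *)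
apply: (@getPex _ (fun df : {linear V -> R^o} => continuous df /\
  forall y, f y = f (lim (nbhs x)) + df (y - lim (nbhs x))
    +o_(y \near x) (y - lim (nbhs x)))).
exists L; split => //; rewrite lim_id; last exact: norm_hausdorff.
suff H : f = (fun y => f x + L (y - x)) +o_x (fun y => y - x).
  by move: H; rewrite funeqE.
apply/eqaddoP => e e0; near=> y.
rewrite !fctE opprD addrA; apply: (@le_trans _ _ (C * `|y - x| ^+ 2)).
  by near: y.
rewrite expr2 mulrA ler_wpM2r//.
have yx : `|x - y| < e / (`|C| + 1).
  near: y; apply: cvgr_dist_lt; first exact: cvg_id.
  by rewrite divr_gt0// ltr_wpDl.
apply: (@le_trans _ _ ((`|C| + 1) * `|y - x|)).
  by rewrite ler_wpM2r// (le_trans (ler_norm _))// lerDl.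
rewrite mulrC -ler_pdivlMr ?ltr_wpDl//. by rewrite distrC ltW.
Unshelve. all: by end_near. Qed.

(** * Local boundedness of convex functions inside the domain *)

Section ConvexFunction.
Context {R : realType} {d : nat} (f : 'rV[R]_d -> \bar R).
Hypotheses (f_gtNy : forall x, f x <> -oo%E) (f_convex : econvex f).
Implicit Types (x y z u : 'rV[R]_d).

Local Notation g := (fine \o f : 'rV[R]_d -> R^o).

Lemma edom_fine x : edom f x -> f x = (g x)%:E.
Proof.
move=> fx; rewrite /= fineK// fin_numE; apply/andP; split; first exact/eqP.
by rewrite lt_eqF.
Qed.

Lemma edom_conv x y (t : R) : 0 <= t <= 1 -> edom f x -> edom f y ->
  edom f (t *: x + (1 - t) *: y) /\ g (t *: x + (1 - t) *: y) <= t * g x + (1 - t) * g y.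
Proof.
move=> t01 fx fy; have := f_convex x y t01; rewrite (edom_fine fx) (edom_fine fy).
rewrite -!EFinM -EFinD => h.
have fd : edom f (t *: x + (1 - t) *: y) by rewrite /edom /= (le_lt_trans h)// ltry.
by split => //; move: h; rewrite (edom_fine fd) lee_fin.
Qed.

Lemma edom_midpoint x z : edom f (x + z) -> edom f (x - z) ->
  2 * g x <= g (x + z) + g (x - z).
Proof.
move=> f1 f2; have t01 : 0 <= (2^-1 : R) <= 1 by lra.
have [_] := edom_conv t01 f1 f2.
rewrite (_ : 2^-1 *: (x + z) + _ = x); first lra.
by apply/rowP => i; rewrite !mxE; lra.
Qed.

Lemma mean_in_convex (L : set 'rV[R]_d) n (p : 'I_n -> 'rV[R]_d) : (0 < n)%N ->
  (forall x y (t : R), 0 <= t <= 1 -> L x -> L y -> L (t *: x + (1 - t) *: y)) ->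
  (forall i, L (p i)) -> L (n%:R^-1 *: \sum_i p i).
Proof.
case: n p => // n p _ Lc; elim: n p => [|n IH] p Lp.
  by rewrite big_ord1 invr1 scale1r.
rewrite big_ord_recr /= scalerDr.
(* The weight of the mean of the first [n.+1] points; the last point gets [1 - t]. *)
pose t : R := n.+1%:R / n.+2%:R.
have nz k : (k.+1%:R : R) != 0 by rewrite pnatr_eq0.
have tE : 1 - t = n.+2%:R^-1.
  apply: (mulIf (nz n.+1)); rewrite mulrBl divfK// mulVf// mul1r.
  by rewrite -[n.+2%:R]natr1 addrAC subrr add0r.
rewrite -tE -[X in X *: \sum_i _](_ : t * n.+1%:R^-1 = _); last first.
  by rewrite /t mulrAC mulfV// mul1r.
rewrite -scalerA; apply: Lc => //; last exact: IH.
rewrite /t divr_ge0//= ler_pdivrMr ?ltr0n// mul1r ler_nat//.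
Qed.

Lemma edom_segment x (s : R) (rho : R) (i : 'I_d) (M : R) : 0 < rho -> `|s| <= rho ->
  edom f (x + rho *: delta_mx 0 i) -> edom f (x - rho *: delta_mx 0 i) ->
  g (x + rho *: delta_mx 0 i) <= M -> g (x - rho *: delta_mx 0 i) <= M ->
  edom f (x + s *: delta_mx 0 i) /\ g (x + s *: delta_mx 0 i) <= M.
Proof.
(* The weight expressing the point as a combination of the two endpoints of the segment. *)
move=> rho0 srho f1 f2 g1 g2; pose t := (1 + s / rho) / 2.
have /andP[s1 s2] : -1 <= s / rho <= 1.
  by rewrite -ler_norml normrM normfV [`|rho|]gtr0_norm// ler_pdivrMr// mul1r.
have t01 : 0 <= t <= 1 by rewrite /t; lra.
have [] := edom_conv t01 f1 f2.
rewrite (_ : t *: (x + _) + _ = x + s *: delta_mx 0 i); last first.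
  by apply/rowP => k; rewrite !mxE /t; field; rewrite gt_eqF.
move=> fs gs; split => //; apply: (le_trans gs).
rewrite [leRHS](_ : M = t * M + (1 - t) * M); last by ring.
by move: t01 => /andP[t0 t1]; rewrite lerD// ler_wpM2l// subr_ge0.
Qed.

(** Above, by the values at the vertices [x + rho e_i] and [x - rho e_i] of a cross-polytope; below,
    by reflecting in [x] and midpoint convexity. *)
Lemma int_dom_locally_bounded x : (0 < d)%N -> int_dom f x ->
  exists r M, [/\ 0 < r, 0 < M & forall z, `|z - x| <= r -> edom f z /\ `|g z| <= M].
Proof.
move=> d0 /nbhs_ballP[r0 /= r00 xr0].
pose rho := r0 / 2; have rho0 : 0 < rho by rewrite divr_gt0.
have frho (s : R) i : `|s| <= rho -> edom f (x + s *: delta_mx 0 i).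
  move=> srho; apply: xr0; rewrite -ball_normE /= opprD addNKr normrN.
  apply: (@le_lt_trans _ _ rho); last by rewrite /rho; lra.
  apply: normr_rV_le => [|k]; first exact: ltW.
  rewrite !mxE; case: (_ && _); rewrite ?mulr1 ?mulr0 ?normr0//; exact: ltW.
have rhoE : `|rho| <= rho by rewrite gtr0_norm.
have NrhoE : `|- rho| <= rho by rewrite normrN.
pose B := \sum_i (`|g (x + rho *: delta_mx 0 i)| + `|g (x - rho *: delta_mx 0 i)|).
have gB i : g (x + rho *: delta_mx 0 i) <= B /\ g (x - rho *: delta_mx 0 i) <= B.
  have : `|g (x + rho *: delta_mx 0 i)| + `|g (x - rho *: delta_mx 0 i)| <= B.
    by rewrite /B (bigD1 i)//= lerDl sumr_ge0// => k _; rewrite addr_ge0.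
  have := ler_norm (g (x + rho *: delta_mx 0 i)).
  have := ler_norm (g (x - rho *: delta_mx 0 i)).
  have := normr_ge0 (g (x + rho *: delta_mx 0 i)).
  have := normr_ge0 (g (x - rho *: delta_mx 0 i)).
  by lra.
have dR0 : 0 < (d%:R : R) by rewrite ltr0n.
have upper z : `|z - x| <= rho / d%:R -> edom f z /\ g z <= B.
  (* [z] is the mean of [d] points, each displaced from [x] along one axis by [d] times a coordinate
     of [z - x]; hence the radius [rho / d]. *)
  move=> zx; pose p i := x + (d%:R * (z - x) 0 i) *: delta_mx 0 i : 'rV[R]_d.
  have -> : z = d%:R^-1 *: \sum_i p i.
    rewrite big_split /= sumr_const card_ord -[x *+ _]scaler_nat scalerDr scalerA.
    rewrite mulVf ?gt_eqF// scale1r -[LHS](subrKC x); congr (_ + _).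
    rewrite [LHS]row_sum_delta scaler_sumr; apply: eq_bigr => i _.
    by rewrite scalerA mulKf ?gt_eqF.
  apply: (@mean_in_convex (fun z => edom f z /\ g z <= B)) => //.
    move=> y y' t t01 [fy gy] [fy' gy']; have [? h] := edom_conv t01 fy fy'; split => //.
    apply: (le_trans h); rewrite [leRHS](_ : B = t * B + (1 - t) * B); last by ring.
    by move: t01 => /andP[t0 t1]; rewrite lerD// ler_wpM2l// subr_ge0.
  move=> i; have fN : edom f (x - rho *: delta_mx 0 i) by rewrite -scaleNr; exact: frho.
  apply: (edom_segment rho0 _ (frho _ i rhoE) fN (gB i).1 (gB i).2).
  rewrite normrM ger0_norm ?ler0n// mulrC -ler_pdivlMr//.
  exact: le_trans (normr_coord _ _) zx.
exists (rho / d%:R), (`|B| + 2 * `|g x| + 1); split.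
- by rewrite divr_gt0.
- by rewrite ltr_wpDl// addr_ge0// mulr_ge0.
move=> z zx; have [fz gz] := upper z zx; split => //.
have zx' : `|(2 *: x - z) - x| <= rho / d%:R.
  rewrite (_ : _ - x = x - z); first by rewrite distrC.
  by apply/rowP => i; rewrite !mxE; ring.
have [fz' gz'] := upper _ zx'.
have := @edom_midpoint x (z - x); rewrite (subrKC x) => /(_ fz).
rewrite (_ : x - (z - x) = 2 *: x - z); last by apply/rowP => i; rewrite !mxE; ring.
move=> /(_ fz'); move: gz gz'; have := ler_norm B; have := ler_norm (- g x).
rewrite normrN /=.
by rewrite ler_norml; have := normr_ge0 (g x); have := normr_ge0 B; lra.
Qed.

End ConvexFunction.

(** * Lipschitz estimates and density of points of differentiability *)

Section ConvexDifferentiability.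
Context {R : realType} {d : nat} (f : 'rV[R]_d -> \bar R).
Hypotheses (f_gtNy : forall x, f x <> -oo%E) (f_convex : econvex f).
Implicit Types (x y z u : 'rV[R]_d).

Local Notation g := (fine \o f : 'rV[R]_d -> R^o).

(** Stretching [h] to norm [r] and using convexity bounds the increment by the fraction [|h| / r] of
    the oscillation [2 * M]; the lower bound follows by applying this to [- h]. *)
Lemma bounded_lipschitz_at x (r M : R) : 0 < r ->
  (forall z, `|z - x| <= r -> edom f z /\ `|g z| <= M) ->
  forall h, `|h| <= r -> `|g (x + h) - g x| <= 2 * M / r * `|h|.
Proof.
move=> r0 fxr.
have edomr h : `|h| <= r -> edom f (x + h) /\ `|g (x + h)| <= M.
  by move=> hr; apply: fxr; rewrite addrC addKr.
have [fx gx] : edom f x /\ `|g x| <= M by apply: fxr; rewrite subrr normr0 ltW.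
have upper h : `|h| <= r -> g (x + h) - g x <= 2 * M / r * `|h|.
  move=> hr; have [->|h0] := eqVneq h 0; first by rewrite addr0 subrr normr0 mulr0.
  have nh0 : 0 < `|h| by rewrite normr_gt0.
  pose t := `|h| / r.
  have t01 : 0 <= t <= 1 by rewrite /t divr_ge0 ?(ltW r0)//= ler_pdivrMr// mul1r.
  have [fh gh] : edom f (x + t^-1 *: h) /\ `|g (x + t^-1 *: h)| <= M.
    apply: edomr; rewrite normrZ /t gtr0_norm ?invr_gt0 ?divr_gt0//.
    by rewrite invf_div divfK ?gt_eqF.
  have [_] := edom_conv f_gtNy f_convex t01 fh fx.
  rewrite (_ : t *: _ + _ = x + h); last first.
    by apply/rowP => k; rewrite !mxE /t; field; rewrite !gt_eqF.
  rewrite -lerBlDr => le1.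
  apply: (@le_trans _ _ (t * (g (x + t^-1 *: h) - g x))); first lra.
  rewrite [leRHS](_ : _ = t * (2 * M)); last by rewrite /t; ring.
  move: t01 gh gx => /andP[t0 _]; rewrite !ler_norml => /andP[? ?] /andP[? ?].
  by rewrite ler_wpM2l//; lra.
move=> h hr; rewrite ler_norml upper// andbT.
have := upper (- h); rewrite normrN => /(_ hr).
have [f1 _] := edomr _ hr; have [|f2 _] := edomr (- h); first by rewrite normrN.
by have := edom_midpoint f_gtNy f_convex f1 f2; lra.
Qed.

Lemma fine_continuous_int_dom x : (0 < d)%N -> int_dom f x -> {for x, continuous g}.
Proof.
move=> d0 fx; have [r [M [r0 M0 fxr]]] := int_dom_locally_bounded f_gtNy f_convex d0 fx.
apply/(@cvgrPdist_le _ _ _ (nbhs x)) => e e0; near=> z.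
have zr : `|z - x| <= r.
  by rewrite distrC; near: z; apply: cvgr_dist_le; first exact: cvg_id.
have := bounded_lipschitz_at r0 fxr zr; rewrite subrKC distrC => /le_trans; apply.
rewrite -ler_pdivlMl ?divr_gt0 ?mulr_gt0// distrC; near: z.
apply: cvgr_dist_le; first exact: cvg_id.
by rewrite mulr_gt0 ?invr_gt0 ?divr_gt0 ?mulr_gt0.
Unshelve. all: by end_near. Qed.

(* Reflecting [h] and midpoint convexity turn the upper bound into a lower one. *)
Lemma differentiable_of_touching x w (rho C : R) : 0 < rho ->
  (forall h, `|h| < rho -> edom f (x + h) /\ g (x + h) - g x <= dot h w + C * `|h| ^+ 2) ->
  differentiable g x.
Proof.
move=> rho0 fx; apply: (@differentiable_of_quadratic _ _ _ (dotr w) _ C).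
  exact: dotr_continuous.
near=> z; rewrite -[z in g z](subrKC x); set h := z - x.
have hrho : `|h| < rho.
  by rewrite distrC; near: z; apply: cvgr_dist_lt; first exact: cvg_id.
have [f1 g1] := fx _ hrho; have [|f2 g2] := fx (- h); first by rewrite normrN.
have := edom_midpoint f_gtNy f_convex f1 f2.
rewrite dotNl normrN in g2; rewrite ler_norml => gm.
by apply/andP; split; rewrite /= /dotr; move: g1 g2 gm => /=; lra.
Unshelve. all: by end_near. Qed.

(* At a maximum of [g - k |z - x|^2] over a small ball, [g] is touched from above
   by a paraboloid; a large [k] keeps the maximum away from the boundary. *)
Lemma dom_grad_dense x (e : R) : (0 < d)%N -> int_dom f x -> 0 < e ->
  exists2 u, dom_grad f u & `|u - x| < e.
Proof.
move=> d0 fx e0; have [r0 [M [r00 M0 fxr0]]] := int_dom_locally_bounded f_gtNy f_convex d0 fx.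
pose r := Num.min (r0 / 2) (e / 2).
have r_gt0 : 0 < r by rewrite lt_min !divr_gt0.
have rr0 : r < r0 by rewrite gt_min; apply/orP; left; lra.
have re : r < e by rewrite gt_min; apply/orP; right; lra.
have int_ball z : `|z - x| < r0 -> int_dom f z.
  move=> zx; apply/nbhs_ballP; exists (r0 - `|z - x|) => /=; first by rewrite subr_gt0.
  move=> y; rewrite -ball_normE /= => zy; suff h : `|y - x| <= r0 by have [] := fxr0 _ h.
  rewrite (_ : y - x = (z - x) - (z - y)); last by apply/rowP => i; rewrite !mxE; ring.
  by rewrite (le_trans (ler_normB _ _))//; lra.
(* On the sphere of radius [r] the penalty is at least [2 * M + 1], more than the oscillation of
   [g], so the centre beats every boundary point. *)
pose k := (2 * M + 1) / r ^+ 2.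
have k0 : 0 < k by rewrite divr_gt0 ?exprn_gt0//; lra.
pose phi z : R := g z - k * dot (z - x) (z - x).
pose K := [set z : 'rV[R]_d | `|z - x| <= r].
have sub_cont : continuous (fun z : 'rV[R]_d => z - x).
  by move=> z; apply: (@cvgB _ _ _ (nbhs z) _ id (cst x)); [exact: cvg_id|exact: cvg_cst].
have [|||c] := @EVT_max_rV R d phi K.
- by exists x; rewrite /K /= subrr normr0 ltW.
- exact: compact_norm_le.
- apply/subspace_continuousP => z Kz; apply: cvg_within_filter.
  apply: cvgB.
    by apply: fine_continuous_int_dom => //; apply: int_ball; exact: le_lt_trans rr0.
  by apply: cvgMl_tmp; exact: cvg_dot (sub_cont z) (sub_cont z).
rewrite inE => Kc cmax.
have fx0 := fxr0 x; rewrite subrr normr0 in fx0; have {fx0} [_ gx] := fx0 (ltW r00).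
have [_ gc] := fxr0 c (ltW (le_lt_trans Kc rr0)).
have cx : `|c - x| < r.
  rewrite lt_neqAle Kc andbT; apply/eqP => cxr.
  have := cmax x; rewrite inE /K /= subrr normr0 => /(_ (ltW r_gt0)).
  rewrite /phi subrr dot0r.
  have : k * r ^+ 2 <= k * dot (c - x) (c - x).
    by rewrite ler_wpM2l ?(ltW k0)// -cxr normr2_le_dot.
  rewrite {1}/k divfK ?gt_eqF ?exprn_gt0//.
  by move: gx gc; rewrite !ler_norml => /andP[? ?] /andP[? ?]; lra.
have fc : int_dom f c by apply: int_ball; exact: lt_trans rr0.
exists c; last exact: lt_trans re.
split => //.
pose rho := r - `|c - x|.
(* Expanding the penalty around [c] gives the slope [2k(c - x)]; the factor [d] compares [dot h h]
   with the squared sup norm. *)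
apply: (@differentiable_of_touching c ((2 * k) *: (c - x)) rho (k * d%:R)).
  by rewrite /rho subr_gt0.
move=> h hrho; have ch : `|c + h - x| <= r.
  by rewrite addrAC (le_trans (ler_normD _ _))//; move: hrho; rewrite /rho; lra.
have [fch _] := fxr0 _ (le_trans ch (ltW rr0)); split => //.
have := cmax (c + h); rewrite inE /K /= => /(_ ch).
rewrite /phi [c + h - x]addrAC !dotDl !dotDr dotZr dotDr.
have : k * dot h h <= k * d%:R * `|h| ^+ 2.
  by rewrite -mulrA ler_wpM2l ?(ltW k0)// (le_trans (ler_norm _))// normr_dot.
rewrite /= [dot h c]dotC [dot h (- x)]dotC; lra.
Qed.

End ConvexDifferentiability.

(** * Subgradients and limits of gradients *)

Section Subdifferential.
Context {R : realType} {d : nat} (f : 'rV[R]_d -> \bar R).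
Hypotheses (f_gtNy : forall x, f x <> -oo%E) (f_convex : econvex f).
Implicit Types (x y z u : 'rV[R]_d).

Local Notation g := (fine \o f : 'rV[R]_d -> R^o).

(** Outside the domain the right-hand side is +oo, so only finite values matter and the inequality
    can be stated in the reals. *)
Lemma subdiffP x y : subdiff f x y <->
  edom f x /\ forall z, edom f (x + z) -> dot z y <= g (x + z) - g x.
Proof.
split=> -[fx xy]; split=> // z.
  move=> fxz; have := xy z.
  by rewrite (edom_fine f_gtNy fx) (edom_fine f_gtNy fxz) -EFinB lee_fin.
rewrite (edom_fine f_gtNy fx).
have [fxz|] := pselect (edom f (x + z)).
  by rewrite (edom_fine f_gtNy fxz) -EFinB lee_fin xy.
rewrite /edom /= => /negP; rewrite -leNgt leye_eq => /eqP ->.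
by rewrite addye// leey.
Qed.

Lemma subdiff_monotone x x' y y' : subdiff f x y -> subdiff f x' y' ->
  0 <= dot (x' - x) (y' - y).
Proof.
move=> /subdiffP[fx xy] /subdiffP[fx' xy'].
have := xy (x' - x); rewrite subrKC => /(_ fx').
have := xy' (x - x'); rewrite subrKC => /(_ fx).
rewrite !dotBl !dotBr; lra.
Qed.

Lemma derive_egrad u z : differentiable g u -> 'D_z g u = dot z (egrad f u).
Proof.
move=> dg; rewrite deriveE// [in LHS](row_sum_delta z) linear_sum.
by apply: eq_bigr => i _; rewrite linearZ /= /egrad /grad mxE deriveE.
Qed.

(** By convexity the difference quotient for a step [t <= 1] is at most the one for step 1. *)
Lemma egrad_subdiff u : dom_grad f u -> subdiff f u (egrad f u).
Proof.
move=> [/interior_subset fu dg]; apply/subdiffP; split => // z fz.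
rewrite -derive_egrad//; apply: derive_le_right; first exact: diff_derivable.
near=> t; have t0 : 0 < t by [].
have t1 : t <= 1 by near: t; exact: nbhs_right_le.
have t01 : 0 <= t <= 1 by rewrite t1 ltW.
have [_] := edom_conv f_gtNy f_convex t01 fz fu.
rewrite (_ : t *: (u + z) + _ = t *: z + u); last first.
  by apply/rowP => k; rewrite !mxE; ring.
by rewrite ler_pdivrMl//; lra.
Unshelve. all: by end_near. Qed.

(** Testing the subgradient inequality at distance [r / 2] from [u] along each axis, in both
    directions, bounds each coordinate. *)
Lemma subdiff_bounded x (r M : R) : 0 < r ->
  (forall z, `|z - x| <= r -> edom f z /\ `|g z| <= M) ->
  forall u y, `|u - x| <= r / 2 -> subdiff f u y -> `|y| <= 4 * M / r.
Proof.
move=> r0 fxr u y ux /subdiffP[fu uy].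
have r20 : 0 < r / 2 by rewrite divr_gt0.
have [_ gu] : edom f u /\ `|g u| <= M by apply: fxr; lra.
have M0 : 0 <= M by exact: le_trans gu.
apply: normr_rV_le => [|i]; first by rewrite divr_ge0 ?(ltW r0)// mulr_ge0.
have hi (s : R) : `|s| <= r / 2 -> s * y 0 i <= 2 * M.
  move=> sr; have [|fs gs] := fxr (u + s *: delta_mx 0 i).
    rewrite addrAC (le_trans (ler_normD _ _))//.
    suff : `|s *: delta_mx 0 i : 'rV[R]_d| <= r / 2 by lra.
    apply: normr_rV_le => [|k]; first exact: ltW.
    rewrite !mxE; case: (_ && _); rewrite ?mulr1 ?mulr0 ?normr0//; exact: ltW.
  have := uy _ fs; rewrite dotZl dot_deltal.
  by move: gu gs; rewrite !ler_norml => /andP[? ?] /andP[? ?]; lra.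
have h1 := hi (r / 2); have h2 := hi (- (r / 2)).
rewrite normrN gtr0_norm// in h2; rewrite gtr0_norm// in h1.
rewrite ler_pdivlMr// -[X in _ * X]gtr0_norm// -normrM ler_norml.
by have {}h1 := h1 (lexx _); have {}h2 := h2 (lexx _); apply/andP; split; lra.
Qed.

(** The subgradient inequality at [u n] passes to the limit, lower semicontinuity handling the value
    at [x], which may be a boundary point of the domain. *)
Lemma grad_limits_subdiff x : lower_semicontinuous f -> int_dom f !=set0 ->
  grad_limits f x `<=` subdiff f x.
Proof.
move=> f_lsc [p /interior_subset fp] y [u [du ux uy]].
have key z : edom f z -> (f x <= (g z - dot (z - x) y)%:E)%E.
  move=> fz; apply/lee_addgt0Pr => e e0; rewrite -EFinD leNgt; apply/negP => fx.
  have [V Vx fV] := f_lsc _ _ fx.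
  have lim : g z - dot (z - u n) (egrad f (u n)) @[n --> \oo] --> g z - dot (z - x) y.
    apply: cvgB; first exact: cvg_cst.
    by apply: cvg_dot => //; apply: cvgB => //; exact: cvg_cst.
  have [n [/fV + le]] : exists n, V (u n) /\
      g z - dot (z - u n) (egrad f (u n)) <= g z - dot (z - x) y + e.
    near \oo => n; exists n; split; first by near: n; exact: ux.
    by near: n; apply: (cvgr_le _ lim); rewrite ltrDl.
  have /subdiffP[fu un] := egrad_subdiff (du n).
  rewrite (edom_fine f_gtNy fu) lte_fin; have := un (z - u n).
  by rewrite subrKC => /(_ fz); lra.
(* Finiteness at [x] comes from [key] applied to one point where [f] is finite. *)
have fx : edom f x by rewrite /edom /= (le_lt_trans (key _ fp))// ltry.
apply/subdiffP; split => // z fz; have := key _ fz.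
rewrite (edom_fine f_gtNy fx) lee_fin (_ : x + z - x = z); first lra.
by rewrite addrC addKr.
Unshelve. all: by end_near. Qed.

Lemma grad_limits_closed x (A : set 'rV[R]_d) : closed A -> range_grad f `<=` A ->
  grad_limits f x `<=` A.
Proof.
move=> cA fA y [u [du _ uy]]; apply: (closed_cvg A cA _ _ uy).
by apply: nearW => n; apply: fA; exists (u n).
Qed.

(* Approach [x] along the ray [x + t s e_j] through points of differentiability:
   monotonicity of the subdifferential bounds the [j]-th coordinates from below. *)
Lemma grad_limit_beyond x y j (s : R) : int_dom f x -> subdiff f x y -> `|s| = 1 ->
  exists2 y', grad_limits f x y' & s * y 0 j <= s * y' 0 j.
Proof.
move=> fx xy s1; have d0 : (0 < d)%N by exact: leq_ltn_trans (ltn_ord j).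
have [r [M [r0 M0 fxr]]] := int_dom_locally_bounded f_gtNy f_convex d0 fx.
pose N := 4 * M / r + `|y|.
have N0 : 0 <= N by rewrite addr_ge0// divr_ge0 ?(ltW r0)// mulr_ge0// ltW.
have /choice[u uP] : forall n, exists u, [/\ dom_grad f u, `|u - x| <= (r / 2) / n.+1%:R,
    `|egrad f u| <= 4 * M / r & s * y 0 j - (d%:R * N) / n.+1%:R <= s * egrad f u 0 j].
  move=> n; have n0 : 0 < (n.+1%:R : R) by [].
  have n1 : (n.+1%:R^-1 : R) <= 1 by rewrite invf_le1// ler1n.
  pose t := (r / 4) / n.+1%:R; have t0 : 0 < t by rewrite !divr_gt0.
  have tr : t <= r / 4 by rewrite /t ler_piMr// divr_ge0// ltW.
  pose p := x + (t * s) *: delta_mx 0 j.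
  have pxE : p - x = (t * s) *: delta_mx 0 j by rewrite /p addrC addKr.
  have px : `|p - x| <= t.
    rewrite pxE; apply: normr_rV_le => [|i]; first exact: ltW.
    rewrite !mxE; case: (_ && _); rewrite ?mulr1 ?mulr0 ?normr0; last exact: ltW.
    by rewrite normrM s1 mulr1 gtr0_norm.
  have fp : int_dom f p.
    apply/nbhs_ballP; exists (r / 2) => /=; first by rewrite divr_gt0.
    move=> z; rewrite -ball_normE /= => pz.
    suff h : `|z - x| <= r by have [] := fxr _ h.
    rewrite (_ : z - x = (p - x) - (p - z)); last by apply/rowP => i; rewrite !mxE; ring.
    by rewrite (le_trans (ler_normB _ _))//; lra.
  (* The point of differentiability is taken within [t / n.+1] of [p]: after division by the step
     [t], the resulting error in the monotonicity inequality still tends to 0. *)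
  have tn0 : 0 < t / n.+1%:R by rewrite divr_gt0.
  have [v dv vp] := dom_grad_dense f_gtNy f_convex d0 fp tn0.
  have tnt : t / n.+1%:R <= t by rewrite ler_piMr// ltW.
  have vx : `|v - x| <= (r / 2) / n.+1%:R.
    rewrite (_ : v - x = (v - p) + (p - x)); last by rewrite addrA subrK.
    rewrite (le_trans (ler_normD _ _))//.
    rewrite (_ : r / 2 / _ = t + t); first by rewrite lerD// ltW// (lt_le_trans vp).
    by rewrite /t; field; rewrite gt_eqF.
  have vr : `|v - x| <= r / 2.
    by apply: (le_trans vx); rewrite ler_piMr// divr_ge0// ltW.
  have vM := subdiff_bounded r0 fxr vr (egrad_subdiff dv).
  exists v; split => //.
  have := subdiff_monotone xy (egrad_subdiff dv).
  rewrite (_ : v - x = (v - p) + (p - x)); last by rewrite addrA subrK.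
  rewrite dotDl pxE dotZl dot_deltal.
  have : dot (v - p) (egrad f v - y) <= t * ((d%:R * N) / n.+1%:R).
    rewrite (le_trans (ler_norm _))// (le_trans (normr_dot _ _))//.
    rewrite [leRHS](_ : _ = d%:R * (t / n.+1%:R * N)); last by ring.
    rewrite ler_wpM2l// ler_pM ?(ltW vp)// (le_trans (ler_normB _ _))//.
    by rewrite /N lerD2r.
  have -> : (egrad f v - y) 0 j = egrad f v 0 j - y 0 j by rewrite !mxE.
  set G : R := egrad f v 0 j => h1 h2.
  have : 0 <= t * (d%:R * N / n.+1%:R + s * (G - y 0 j)).
    rewrite mulrDr [t * (s * _)]mulrA.
    by rewrite (le_trans h2)// lerD2r.
  by rewrite pmulr_rge0// mulrBr addrA subr_ge0 lerBlDr [_ + s * G]addrC.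
(* Gradients near [x] are bounded, so a subsequence converges; its limit is the required element. *)
have [k [l [kn kl]]] := @bounded_seq_cvg _ _ (fun n => egrad f (u n)) (4 * M / r)
  (fun n => let: And4 _ _ h _ := uP n in h).
have kn1 n : (k n).+1%:R^-1 <= n.+1%:R^-1 :> R.
  by rewrite lef_pV2 ?posrE// ler_nat ltnS.
exists l.
  exists (u \o k); split => //= [n|]; first by have [] := uP (k n).
  apply: (@cvg_of_harmonic_bound _ _ _ _ (r / 2)) => n; have [_ h _ _] := uP (k n).
  by apply: (le_trans h); rewrite ler_wpM2l// divr_ge0// ltW.
have lim1 : s * egrad f (u (k n)) 0 j @[n --> \oo] --> s * l 0 j.
  by apply: cvgMl_tmp; exact: cvg_coord.
have lim2 : s * y 0 j - d%:R * N / n.+1%:R @[n --> \oo] --> s * y 0 j.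
  apply: (@cvg_of_harmonic_bound _ R^o _ _ (d%:R * N)) => n.
  by rewrite addrC addKr normrN ger0_norm// !mulr_ge0.
apply: ler_cvg_to lim2 lim1 _; apply: nearW => n.
have [_ _ _ h] := uP (k n); apply: le_trans h.
by rewrite lerD2l lerN2 ler_wpM2l// mulr_ge0.
Qed.

End Subdifferential.

(** * Covering the singular set *)

Section ClarkeSingularities.
Context {R : realType} {d : nat} (f : 'rV[R]_d -> \bar R) (j : 'I_d).
Implicit Types x y : 'rV[R]_d.

Lemma grad_limits_clarke x : int_dom f x -> grad_limits f x `<=` clarke f x.
Proof.
move=> fx y xy; split; first exact: subset_closure.
by apply: subset_closure; exact: sub_gen_smallest.
Qed.

(** The hyperplane where the [j]-th coordinate equals [c] is closed and convex, hence contains the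
    closed convex hull. *)
Lemma clarke_coord_cst x (c : R) : (forall y, grad_limits f x y -> y 0 j = c) ->
  forall y, clarke f x y -> y 0 j = c.
Proof.
move=> xc y [_]; pose P := [set z : 'rV[R]_d | z 0 j = c].
have Pclosed : closed P.
  apply: (@preimage_closed _ _ (fun z : 'rV[R]_d => z 0 j) [set c]).
    by move=> z _; exact: coord_continuous.
  exact: closed_eq.
suff : conv_hull (grad_limits f x) `<=` P.
  by move=> /closureS/[apply]; rewrite -(closure_id P).1.
apply: smallest_sub => //.
move=> z z' t; rewrite !inE /P /= => zc z'c.
by rewrite !mxE zc z'c -mulrDl addrC subrK mul1r.
Qed.

Lemma Sigma_clarke_grad_limits x : Sigma j (clarke f) x ->
  exists y1 y2, [/\ grad_limits f x y1, grad_limits f x y2 & y1 0 j <> y2 0 j].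
Proof.
move=> [_ [y1 [y2 [[xy1 _] [xy2 _] y12]]]]; apply: contrapT => all_eq; apply: y12.
have [[y xy]|none] := pselect (exists y, grad_limits f x y).
  have cst z : grad_limits f x z -> z 0 j = y 0 j.
    by move=> xz; apply: contrapT => zy; apply: all_eq; exists z, y.
  by rewrite (clarke_coord_cst cst xy1) (clarke_coord_cst cst xy2).
(* Without limits of gradients the premise holds vacuously, with 0 as an arbitrary constant. *)
have cst z : grad_limits f x z -> z 0 j = 0 by move=> xz; case: none; exists z.
by rewrite (clarke_coord_cst cst xy1) (clarke_coord_cst cst xy2).
Qed.

End ClarkeSingularities.

(** * Compact families of affine minorants and single pieces of the cover *)

Section Cover.
Context {R : realType} {d : nat} (f : 'rV[R]_d -> \bar R) (j : 'I_d).
Hypothesis f_gtNy : forall x, f x <> -oo%E.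
Variable A : set 'rV[R]_d.
Hypothesis A_closed : closed A.
Implicit Types (x y : 'rV[R]_d) (Q : set ('rV[R]_d * R)).

Lemma slope_diff_compact Q1 Q2 : compact Q1 -> compact Q2 -> compact (slope_diff Q1 Q2).
Proof.
move=> cQ1 cQ2; rewrite /slope_diff image2E; apply: continuous_compact; last exact: compact_setX.
apply: continuous_subspaceT.
rewrite (_ : uncurry _ = fun p => p.2.1 - p.1.1); last by apply/funext => -[].
have c11 : continuous (fun p : ('rV[R]_d * R) * ('rV[R]_d * R) => p.1.1).
  by move=> p; apply: (@cvg_comp _ _ _ fst fst); exact: cvg_fst.
have c21 : continuous (fun p : ('rV[R]_d * R) * ('rV[R]_d * R) => p.2.1).
  by move=> p; apply: (@cvg_comp _ _ _ snd fst); [exact: cvg_snd|exact: cvg_fst].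
by move=> p; exact: cvgB (c21 p) (c11 p).
Qed.

(** One parameter [k] shrinks the ball of slopes and enlarges the bound on the constants, which
    makes the family compact; in use, [k] is fixed first and the centre [q] afterwards. *)
Definition minorants (q : 'rV[R]_d) (k : nat) : set ('rV[R]_d * R) :=
  [set p | [/\ forall z, ((dot z p.1 - p.2)%:E <= f z)%E, A p.1,
    `|p.1 - q| <= k.+1%:R^-1 & `|p.2 - 0| <= k%:R]].

Lemma minorants_compact q k : compact (minorants q k).
Proof.
have fst_cont : continuous (@fst 'rV[R]_d R) by move=> p; exact: cvg_fst.
have aff_cont z : continuous (fun p : 'rV[R]_d * R => dot z p.1 - p.2).
  move=> p; apply: cvgB; last exact: cvg_snd.
  by apply: cvg_dot; [exact: cvg_cst|exact: cvg_fst].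
pose K := [set y : 'rV[R]_d | `|y - q| <= k.+1%:R^-1] `*` [set t : R | `|t - 0| <= k%:R].
pose M := \bigcap_z [set p : 'rV[R]_d * R | ((dot z p.1 - p.2)%:E <= f z)%E].
have -> : minorants q k = M `&` (fst @^-1` A) `&` K.
  apply/seteqP; split=> [p [pM pA pq pk]|p [[pM pA] [pq pk]]].
    by split=> //; split=> // z _; exact: pM.
  by split=> // z; exact: pM.
have cK : compact K.
  apply: compact_setX; first exact: compact_norm_le.
  rewrite (_ : [set t | _] = `[- k%:R, k%:R]%classic); first exact: segment_compact.
  by apply/seteqP; split=> t; rewrite /= in_itv /= subr0 ler_norml.
rewrite setIC; apply: compact_closedI => //; apply: closedI; last first.
  by apply: preimage_closed A_closed => p _; exact: fst_cont.
(* Where [f z] is finite the constraint is a closed half-space; where it is +oo it is the whole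
   space. *)
apply: closed_bigI => z _; have := @f_gtNy z; case: (f z) => [r| |] // _.
  apply: (@preimage_closed _ _ (fun p : 'rV[R]_d * R => dot z p.1 - p.2) [set t | t <= r]).
    by move=> p _; exact: aff_cont.
  exact: closed_le.
rewrite (_ : [set p | _] = setT); first exact: closedT.
by apply/seteqP; split => // p _; rewrite /= leey.
Qed.

Lemma rat_dense_rV (y : 'rV[R]_d) (e : R) : 0 < e ->
  exists q : 'rV[rat]_d, `|y - map_mx ratr q| <= e.
Proof.
move=> e0; have /choice[q qP] : forall i, exists r : rat, `|y 0 i - ratr r| <= e.
  move=> i; have ye : y 0 i - e < y 0 i + e by lra.
  have [r] := rat_in_itvoo ye.
  rewrite in_itv /= => /andP[? ?]; exists r; rewrite ler_norml; apply/andP; split; lra.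
exists (\row_i q i); apply: normr_rV_le => [|i]; first exact: ltW.
by rewrite !mxE.
Qed.

Lemma theta_near (w : 'rV[R]_d) (e : R) : w 0 j != 0 -> 0 < e ->
  exists2 rho : R, 0 < rho & forall v, `|v - w| < rho ->
    `|(v 0 j)^-1 *: v - (w 0 j)^-1 *: w| <= e.
Proof.
move=> w0 e0; pose th (v : 'rV[R]_d) := (v 0 j)^-1 *: v.
have cth : th v @[v --> w] --> th w.
  have c1 : (v 0 j)^-1 @[v --> w] --> (w 0 j)^-1.
    by apply: (@cvgV _ _ (nbhs w) _ (fun v : 'rV[R]_d => v 0 j)) => //; exact: coord_continuous.
  have c2 : (v : 'rV[R]_d) @[v --> w] --> w by exact: cvg_id.
  exact: (@cvgZ R 'rV[R]_d _ (nbhs w) _ (fun v : 'rV[R]_d => (v 0 j)^-1) id _ _ c1 c2).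
have /nbhs_ballP[rho /= rho0 wrho] : \forall v \near w, `|th w - th v| <= e.
  by move/cvgrPdist_le : cth; exact.
exists rho => // v vw; rewrite distrC; apply: wrho.
by rewrite -ball_normE /= distrC.
Qed.

Definition cover_piece (eps : R) (C : set 'rV[R]_d) (h : 'rV[R]_d -> R) : Prop :=
  [/\ compact C /\ C `<=` diff_set A, forall y, C y -> 0 < y 0 j,
      Hclass j (theta j C) h & (diam (theta j C) < eps%:E)%E].

Definition slope_separated (eps : R) Q1 Q2 : Prop :=
  (exists c1 c2 : R, [/\ c1 < c2, forall p, Q1 p -> p.1 0 j <= c1 &
    forall p, Q2 p -> c2 <= p.1 0 j]) /\
  (diam (theta j (slope_diff Q1 Q2)) < eps%:E)%E.

Lemma separated_cover_piece (eps : R) Q1 Q2 :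
  compact Q1 -> compact Q2 -> Q1 !=set0 -> Q2 !=set0 ->
  (forall p, Q1 p -> A p.1) -> (forall p, Q2 p -> A p.1) -> slope_separated eps Q1 Q2 ->
  exists2 h, cover_piece eps (slope_diff Q1 Q2) h &
    forall x s, envelope_at j Q1 (x 0 j) (col' j x) s ->
      envelope_at j Q2 (x 0 j) (col' j x) s -> h x = 0.
Proof.
move=> cQ1 cQ2 Q10 Q20 Q1A Q2A [[c1 [c2 [c12 Q1c Q2c]]] dQ].
have [h hH h0] := Hclass_crossing cQ1 cQ2 Q10 Q20 c12 Q1c Q2c.
exists h => //; split => //.
- split; first exact: slope_diff_compact.
  by move=> _ [p1 Qp1 [p2 Qp2 <-]]; exists p2.1; [exact: Q2A|exists p1.1 => //; exact: Q1A].
- move=> _ [p1 Qp1 [p2 Qp2 <-]]; rewrite !mxE subr_gt0.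
  by rewrite (le_lt_trans (Q1c _ Qp1))// (lt_le_trans c12)// Q2c.
Qed.

(** A filler for indices that capture no point, built from two singletons, so that the normalised
    difference set is one point of diameter 0. *)
Lemma cover_piece_ex (eps : R) : 0 < eps ->
  ~ (forall y z, A y -> A z -> y 0 j = z 0 j) -> exists C h, cover_piece eps C h.
Proof.
move=> eps0 nA.
have [y [z [Ay Az yz]]] : exists y z, [/\ A y, A z & y 0 j < z 0 j].
  apply: contrapT => none; apply: nA => y z Ay Az; apply/eqP; rewrite eq_le !leNgt.
  by apply/andP; split; apply/negP => yz; apply: none; [exists z, y|exists y, z].
pose Q1 := [set (y, 0 : R)]; pose Q2 := [set (z, 0 : R)].
have [|||||||h] := @separated_cover_piece eps Q1 Q2; rewrite ?/Q1 ?/Q2.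
- exact: compact_set1.
- exact: compact_set1.
- by exists (y, 0).
- by exists (z, 0).
- by move=> _ ->.
- by move=> _ ->.
- split; first by exists (y 0 j), (z 0 j); split => // _ ->.
  apply: (@le_lt_trans _ _ 0%E); last by rewrite lte_fin.
  apply: ge_ereal_sup => _ [_ [_ [_ -> [_ -> <-]] <-] [_ [_ [_ -> [_ -> <-]] <-] <-]].
  by rewrite subrr /enorm dot0r sqrtr0.
by move=> hC _; exists (slope_diff Q1 Q2), h.
Qed.

End Cover.

(** * Countable cover of the singular set *)

Section SingularCover.
Context {R : realType} {d : nat} (f : 'rV[R]_d -> \bar R) (j : 'I_d).
Hypothesis f_gtNy : forall x, f x <> -oo%E.
Variable A : set 'rV[R]_d.
Hypothesis A_closed : closed A.
Implicit Types (x y : 'rV[R]_d).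

Local Notation minorants := (minorants f A).

Lemma subdiff_minorant x y : subdiff f x y ->
  forall z, ((dot z y - (dot x y - fine (f x)))%:E <= f z)%E.
Proof.
move=> [fx xy] z; have := xy (z - x); rewrite subrKC (edom_fine f_gtNy fx).
have := @f_gtNy z; case: (f z) => [r| |] // _; last by move=> _; rewrite leey.
by rewrite -EFinB !lee_fin dotBl /=; lra.
Qed.

(** The minorant given by a subgradient at [x] touches [f] there, and every other minorant stays
    below. *)
Lemma minorants_envelope q k x y (a : R) : subdiff f x y -> a = dot x y - fine (f x) ->
  minorants q k (y, a) -> envelope_at j (minorants q k) (x 0 j) (col' j x) (fine (f x)).
Proof.
move=> [fx _] aE Qya; split.
  by exists (y, a) => //; rewrite affine_at_dot /= aE; ring.
move=> p [/(_ x) + _ _ _]; rewrite affine_at_dot.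
by rewrite (edom_fine f_gtNy fx) lee_fin.
Qed.

Lemma minorants_near (q y : 'rV[R]_d) k (e : R) : k.+1%:R^-1 <= e -> `|y - q| <= k.+1%:R^-1 ->
  forall p, minorants q k p -> `|p.1 - y| <= 2 * e.
Proof.
move=> ke yq p [_ _ pq _].
rewrite (_ : p.1 - y = (p.1 - q) - (y - q)); last by apply/rowP => i; rewrite !mxE; ring.
by rewrite (le_trans (ler_normB _ _))// mulr2n mulrDl mul1r lerD// (le_trans _ ke).
Qed.

(** The index [t] consists of two rational centres and a natural number, hence ranges over a
    countable type. *)
Definition captured (eps : R) (t : 'rV[rat]_d * 'rV[rat]_d * nat) x : Prop :=
  let Q1 := minorants (map_mx ratr t.1.1) t.2 in
  let Q2 := minorants (map_mx ratr t.1.2) t.2 in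
  slope_separated j eps Q1 Q2 /\
  exists s, envelope_at j Q1 (x 0 j) (col' j x) s /\ envelope_at j Q2 (x 0 j) (col' j x) s.

Lemma captured_ex (eps : R) x : 0 < eps -> Sigma_in j A (subdiff f) x ->
  exists t, captured eps t x.
Proof.
move=> eps0 [_ [y1 [y2 [[xy1 Ay1] [xy2 Ay2] /eqP y12]]]].
wlog {y12} y12 : y1 y2 xy1 xy2 Ay1 Ay2 / y1 0 j < y2 0 j.
  by move=> H; move: y12; rewrite neq_lt => /orP[]; exact: H.
pose w := y2 - y1; have wj : w 0 j = y2 0 j - y1 0 j by rewrite !mxE.
have w0 : 0 < w 0 j by rewrite wj subr_gt0.
pose sd : R := Num.sqrt d%:R; have sd0 : 0 <= sd by exact: sqrtr_ge0.
have sd1 : 0 < sd + 1 by rewrite ltr_wpDl.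
(* Two points this close to a common one in the sup norm are within [eps / 2] in the Euclidean norm;
   the added 1 keeps the denominator positive. *)
have e0 : 0 < eps / (4 * (sd + 1)) by rewrite divr_gt0// mulr_gt0.
have w_neq0 : w 0 j != 0 by rewrite gt_eqF.
have [rho rho0 wrho] := theta_near w_neq0 e0.
(* Each slope moves by at most [2 * dl]: their difference then stays within [rho] of [w], and each
   [j]-th coordinate moves by at most a third of the gap [w 0 j]. *)
pose dl := Num.min (rho / 5) (w 0 j / 6).
have dl0 : 0 < dl by rewrite lt_min !divr_gt0.
have dl_rho : 4 * dl < rho.
  have : dl <= rho / 5 by rewrite ge_min lexx.
  lra.
have dl_w : 2 * dl <= w 0 j / 3.
  have : dl <= w 0 j / 6 by rewrite ge_min lexx orbT.
  lra.
pose a1 := dot x y1 - fine (f x); pose a2 := dot x y2 - fine (f x).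
(* Any [k] above [B] bounds both constants and satisfies [1 / k.+1 <= dl]. *)
pose B := `|a1| + `|a2| + dl^-1.
have B0 : 0 <= B by rewrite !addr_ge0// invr_ge0 ltW.
pose k := Num.bound B.
have kB : B < k%:R by exact: archi_boundP.
have dlV : 0 < dl^-1 by rewrite invr_gt0.
have k0 : 0 < (k.+1%:R : R) by [].
have k_dl : k.+1%:R^-1 <= dl.
  rewrite -[dl]invrK lef_pV2 ?posrE// -natr1.
  by have := normr_ge0 a1; have := normr_ge0 a2; move: kB; rewrite /B; lra.
have kV : 0 < (k.+1%:R^-1 : R) by rewrite invr_gt0.
have [q1 yq1] := rat_dense_rV y1 kV; have [q2 yq2] := rat_dense_rV y2 kV.
pose Q1 := minorants (map_mx ratr q1) k; pose Q2 := minorants (map_mx ratr q2) k.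
have Q1y : Q1 (y1, a1).
  split => //=; first exact: subdiff_minorant.
  by rewrite subr0; have := normr_ge0 a2; move: kB; rewrite /B; lra.
have Q2y : Q2 (y2, a2).
  split => //=; first exact: subdiff_minorant.
  by rewrite subr0; have := normr_ge0 a1; move: kB; rewrite /B; lra.
have Q1near := minorants_near k_dl yq1; have Q2near := minorants_near k_dl yq2.
exists (q1, q2, k); split; last first.
  by exists (fine (f x)); split; [exact: minorants_envelope Q1y|exact: minorants_envelope Q2y].
split.
  exists (y1 0 j + w 0 j / 3), (y2 0 j - w 0 j / 3); split => [|p /Q1near py|p /Q2near py].
  - by rewrite wj in w0 *; lra.
  - have := le_trans (normr_coord (p.1 - y1) j) py.
    by rewrite !mxE ler_norml => /andP[_ ?]; lra.
  - have := le_trans (normr_coord (p.1 - y2) j) py.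
    by rewrite !mxE ler_norml => /andP[? _]; lra.
have thC v : slope_diff Q1 Q2 v -> `|(v 0 j)^-1 *: v - (w 0 j)^-1 *: w| <= eps / (4 * (sd + 1)).
  move=> [p1 /Q1near py1 [p2 /Q2near py2 <-]]; apply: wrho.
  rewrite (_ : p2.1 - p1.1 - w = (p2.1 - y2) - (p1.1 - y1)); last first.
    by apply/rowP => i; rewrite !mxE; ring.
  by rewrite (le_lt_trans (ler_normB _ _))// (le_lt_trans _ dl_rho)//; lra.
(* The margin [eps / 2] keeps the inequality strict after taking the supremum. *)
apply: (@le_lt_trans _ _ (eps / 2)%:E); last by rewrite lte_fin; lra.
apply: ge_ereal_sup => _ [_ [v /thC vC <-] [_ [v' /thC v'C <-] <-]].
rewrite lee_fin (le_trans (enorm_le _))// -/sd.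
apply: (@le_trans _ _ ((sd + 1) * (2 * (eps / (4 * (sd + 1)))))).
  rewrite ler_pM ?lerDl//.
  rewrite (_ : _ - _ = ((v 0 j)^-1 *: v - (w 0 j)^-1 *: w) -
    ((v' 0 j)^-1 *: v' - (w 0 j)^-1 *: w)); last by apply/rowP => i; rewrite !mxE; ring.
  by rewrite (le_trans (ler_normB _ _))//; lra.
by rewrite le_eqVlt; apply/orP; left; apply/eqP; field; rewrite gt_eqF.
Qed.

Lemma singular_set_cover (eps : R) : 0 < eps ->
  ~ (forall y z, A y -> A z -> y 0 j = z 0 j) ->
  exists C h, zero_set_cover j A (Sigma_in j A (subdiff f)) C h /\
    (forall n, (diam (theta j (C n)) < eps%:E)%E).
Proof.
move=> eps0 nA.
have /choice[Ch ChP] : forall n, exists Ch : set 'rV[R]_d * ('rV[R]_d -> R),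
    cover_piece j A eps Ch.1 Ch.2 /\
    forall t x, unpickle n = Some t -> captured eps t x -> Ch.2 x = 0.
  move=> n; have [C0 [h0 Ch0]] := cover_piece_ex eps0 nA.
  (* An index is used only if it captures some point, which also shows that both families are
     nonempty; otherwise the filler is taken. *)
  have [[t [x [nt [sep [s [e1 e2]]]]]]|none] := pselect (exists t x,
      unpickle n = Some t /\ captured eps t x); last first.
    by exists (C0, h0); split => // t x nt tx; case: none; exists t, x.
  have cQ q k : compact (minorants q k) by exact: minorants_compact.
  have [[p1 Qp1 _] _] := e1; have [[p2 Qp2 _] _] := e2.
  have [h Ch hP] : exists2 h, cover_piece j A eps (slope_diff (minorants (map_mx ratr t.1.1) t.2)
      (minorants (map_mx ratr t.1.2) t.2)) h & forall x s,
      envelope_at j (minorants (map_mx ratr t.1.1) t.2) (x 0 j) (col' j x) s ->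
      envelope_at j (minorants (map_mx ratr t.1.2) t.2) (x 0 j) (col' j x) s -> h x = 0.
    apply: separated_cover_piece => //.
    - by exists p1.
    - by exists p2.
    - by move=> p [].
    - by move=> p [].
  exists (slope_diff (minorants (map_mx ratr t.1.1) t.2)
    (minorants (map_mx ratr t.1.2) t.2), h); split => //.
  by move=> t' x'; rewrite nt => -[<-] [_ [s' [e1' e2']]]; exact: hP e1' e2'.
exists (fun n => (Ch n).1), (fun n => (Ch n).2); split; last by move=> n; have [[]] := ChP n.
split=> [n|n|n|x Sx].
- by have [[]] := ChP n.
- by have [[]] := ChP n.
- by have [[]] := ChP n.
have [t tx] := captured_ex eps0 Sx.
exists (pickle t) => //=; have [_ h] := ChP (pickle t).
by apply: h tx; rewrite pickleK.
Qed.

End SingularCover.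

(** [f_gtNy] encodes values in R with +oo adjoined. The singular set of [clarke f] lies in that of
    [subdiff f] relative to [A], which lies in the full one; inside the domain [grad_limit_beyond]
    closes the loop. *)
Theorem theorem3p1 (R : realType) (d : nat) (f : 'rV[R]_d -> \bar R)
    (f_gtNy : forall x, f x <> -oo%E)
    (f_closed_convex : closed_convex f)
    (D_neq0 : int_dom f !=set0)
    (j : 'I_d) (A : set 'rV[R]_d)
    (A_closed : closed A)
    (range_sub_A : range_grad f `<=` A) :
  [/\ Sigma j (subdiff f) `&` int_dom f = Sigma j (clarke f) `&` int_dom f,
      Sigma j (clarke f) `&` int_dom f = Sigma_in j A (subdiff f) `&` int_dom f,
      Sigma j (clarke f) `<=` Sigma_in j A (subdiff f),
      (forall y z, A y -> A z -> y 0 j = z 0 j) ->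
        Sigma_in j A (subdiff f) = set0 &
      ~ (forall y z, A y -> A z -> y 0 j = z 0 j) ->
        (exists C h, zero_set_cover j A (Sigma_in j A (subdiff f)) C h) /\
        (forall eps : R, 0 < eps -> exists C h,
          zero_set_cover j A (Sigma_in j A (subdiff f)) C h /\
          (forall n, (diam (theta j (C n)) < eps%:E)%E))].
Proof.
have [f_convex f_lsc _] := f_closed_convex.
have clarke_in : Sigma j (clarke f) `<=` Sigma_in j A (subdiff f).
  move=> x /Sigma_clarke_grad_limits[y1 [y2 [xy1 xy2 y12]]].
  have sub : grad_limits f x `<=` subdiff f x by exact: grad_limits_subdiff.
  have subA : grad_limits f x `<=` A by exact: grad_limits_closed.
  split; first by exists y1; exact: sub.
  exists y1, y2; split => //.
    by split; [exact: sub|exact: subA].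
  by split; [exact: sub|exact: subA].
have in_subdiff : Sigma_in j A (subdiff f) `<=` Sigma j (subdiff f).
  by move=> x [x0 [y1 [y2 [[? _] [? _] ?]]]]; split => //; exists y1, y2.
have subdiff_clarke x : int_dom f x -> Sigma j (subdiff f) x -> Sigma j (clarke f) x.
  move=> fx [_ [y1 [y2 [[xy1 _] [xy2 _] /eqP y12]]]].
  wlog {y12} y12 : y1 y2 xy1 xy2 / y1 0 j < y2 0 j.
    by move=> H; move: y12; rewrite neq_lt => /orP[]; exact: H.
  (* Moving in direction [- e_j] for the smaller coordinate and [e_j] for the larger one only widens
     the gap between them. *)
  have [z1 xz1 z1y1] := grad_limit_beyond f_gtNy f_convex j fx xy1 (normrN1 R).
  have [z2 xz2 z2y2] := grad_limit_beyond f_gtNy f_convex j fx xy2 (normr1 R).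
  split; first by exists z1; exact: grad_limits_clarke.
  exists z1, z2; split; [split => //; exact: grad_limits_clarke..|].
  by apply/eqP; rewrite lt_eqF//; lra.
split => //.
- apply/seteqP; split=> x [xS fx]; split => //; first exact: subdiff_clarke.
  by apply: in_subdiff; exact: clarke_in.
- apply/seteqP; split=> x [xS fx]; split => //; first exact: clarke_in.
  by apply: subdiff_clarke => //; exact: in_subdiff.
- move=> Aj; apply/seteqP; split => // x [_ [y1 [y2 [[_ A1] [_ A2] y12]]]].
  by apply: y12; exact: Aj.
move=> nA; split=> [|eps eps0]; last exact: singular_set_cover.
(* Without a diameter requirement, any tolerance will do; here it is 1. *)
by have [C [h [Ch _]]] := singular_set_cover f_gtNy A_closed ltr01 nA; exists C, h.
Qed.
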